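(* Let $g$ be a non-negative function defined on $\mathbb{R}^n$, and $q\in\mathbb{R}\cup\{+\infty\}$. Assume that the following conditions are satisfied: (i) $g$ is $q$-concave on $\mathbb{R}^n$. (ii) $\mathbb{R}^n\setminus g^{-1}(0)$ is bounded, and its interior is not empty. (iii) $q\geq 1$. For $(x,t)\in\mathbb{R}^n\times(0,+\infty)$ let $$Pg(x,t)=\frac{2t}{\sigma_n(S^n)}\int_{\mathbb{R}^n}\left(|x-y|^2+t^2\right)^{-(n+1)/2}g(y)\,\mathrm{d}y.$$ Then, for any $t\in(0,+\infty)$, the function $Pg(\cdot,t):\mathbb{R}^n\to(0,+\infty)$ is strictly $q/(1-q)$-concave on $\mathbb{R}^n$.
   Context: $S^n$ is the $n$-dimensional unit sphere (in $\mathbb{R}^{n+1}$) and $\sigma_n$ is the $n$-dimensional spherical Lebesgue measure. The exponent $q/(1-q)$ is understood as $-1$ when $q=+\infty$ and as $-\infty$ when $q=1$. For $a,b \in [0,+\infty)$, $\lambda \in [0,1]$ and $p \in \mathbb{R} \cup \{\pm\infty\}$, put $M_p(a,b;\lambda) = 0$ if $ab=0$; and, if $ab>0$, $M_p(a,b;\lambda) = ((1-\lambda)a^p + \lambda b^p)^{1/p}$ for $p \in \mathbb{R}\setminus\{0\}$, $M_0(a,b;\lambda) = a^{1-\lambda}b^\lambda$, $M_{+\infty}(a,b;\lambda) = \max\{a,b\}$, $M_{-\infty}(a,b;\lambda) = \min\{a,b\}$. Write $x_\lambda = (1-\lambda)x_0 + \lambda x_1$. A non-negative function $f$ on a convex set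 $A \subset \mathbb{R}^n$ is $p$-concave on $A$ if $f(x_\lambda) \geq M_p(f(x_0),f(x_1);\lambda)$ for all $x_0,x_1 \in A$ and $\lambda \in [0,1]$. It is strictly $p$-concave if moreover this inequality is strict for all distinct $x_0,x_1\in A$ and all $\lambda\in(0,1)$. *)

(* Defs.v *)
From HB Require Import structures.
From mathcomp Require Import all_boot all_order all_algebra.
From mathcomp Require Import all_classical all_reals all_analysis.

Set Implicit Arguments.
Unset Strict Implicit.
Unset Printing Implicit Defensive.

Import Order.TTheory GRing.Theory Num.Theory.
Import numFieldNormedType.Exports.

Local Open Scope classical_set_scope.
Local Open Scope ring_scope.

(* The library norm on 'rV[R]_n is the sup norm; it induces the same topology
   and the same bounded sets as this one. *)
Definition enorm (R : realType) (n : nat) (x : 'rV[R]_n) : R :=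
  Num.sqrt (\sum_(i < n) x ord0 i ^+ 2).

(* Borel sets of 'rV[R]_n, as the sigma-algebra generated by the coordinates
   (same construction as the library's for n.-tuple). *)
Section measurable_rV.
Context (R : realType) (n : nat).

Let coords : 'I_n -> 'rV[R]_n -> measurableTypeR R := fun i x => x ord0 i.

Let rV_set0 : g_sigma_preimage coords set0.
Proof. exact: sigma_algebra0. Qed.

Let rV_setC A : g_sigma_preimage coords A -> g_sigma_preimage coords (~` A).
Proof. exact: sigma_algebraC. Qed.

Let rV_bigcup (F : (set 'rV[R]_n)^nat) :
  (forall i, g_sigma_preimage coords (F i)) ->
  g_sigma_preimage coords (\bigcup_i F i).
Proof. exact: sigma_algebra_bigcup. Qed.

HB.instance Definition _ := @isMeasurable.Build default_measure_display
  'rV[R]_n (g_sigma_preimage coords) rV_set0 rV_setC rV_bigcup.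

End measurable_rV.

Lemma measurable_coord (R : realType) (n : nat) (i : 'I_n) :
  measurable_fun [set: 'rV[R]_n]
    (fun x : 'rV[R]_n => x ord0 i : measurableTypeR R).
Proof.
move=> _ Y mY; rewrite setTI; apply: sub_sigma_algebra => /=.
rewrite -bigcup_seq/=; exists i => /=; first by rewrite mem_index_enum.
by exists Y => //; rewrite setTI.
Qed.

Lemma measurable_fun_rV (d : measure_display) (T : measurableType d)
    (R : realType) (n : nat) (f : T -> 'rV[R]_n) :
  (forall i, measurable_fun [set: T]
    (fun x => f x ord0 i : measurableTypeR R)) ->
  measurable_fun [set: T] f.
Proof.
move=> mf _ Y mY; rewrite setTI.
suff : @measurable _ 'rV[R]_n `<=` image_set_system setT f measurable.
  by move=> /(_ _ mY); rewrite /image_set_system /= setTI.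
apply: smallest_sub.
  by apply: sigma_algebra_image; exact: sigma_algebra_measurable.
move=> A; rewrite -bigcup_seq/= => -[i _ [B mB <-]].
rewrite /image_set_system /= !setTI -comp_preimage.
by have := mf i measurableT _ mB; rewrite setTI.
Qed.

Definition rV_cons (R : realType) (n : nat)
    (z : measurableTypeR R * 'rV[R]_n) : 'rV[R]_n.+1 :=
  row_mx (z.1%:M : 'rV[R]_1) z.2.

Lemma measurable_rV_cons (R : realType) (n : nat) :
  measurable_fun setT (@rV_cons R n).
Proof.
apply: measurable_fun_rV => i.
case: (@splitP 1 n i) => j ij.
  have -> : i = lshift n j :> 'I_(1 + n) by exact/val_inj.
  rewrite [X in measurable_fun _ X](_ : _ = fst) //.
  by apply/funext => z; rewrite /rV_cons (@row_mxEl _ 1 1 n) mxE !ord1 eqxx mulr1n.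
have -> : i = rshift 1 j :> 'I_(1 + n) by exact/val_inj.
rewrite [X in measurable_fun _ X](_ : _ =
    (fun x : 'rV[R]_n => x ord0 j : measurableTypeR R) \o snd).
  exact: measurableT_comp (@measurable_coord R n j) measurable_snd.
by apply/funext => z; rewrite /rV_cons (@row_mxEr _ 1 1 n).
Qed.

(* n-dimensional Lebesgue measure: iterated product of the one-dimensional
   one. *)
Fixpoint lebesgue_rV (R : realType) (n : nat) : set 'rV[R]_n -> \bar R :=
  if n is m.+1
  then pushforward (@lebesgue_measure R \x @lebesgue_rV R m)%E (@rV_cons R m)
  else \d_(0 : 'rV[R]_0).

Section lebesgue_rV_step.
Local Open Scope ereal_scope.
Context (R : realType) (n : nat).
Variable mu : {sigma_finite_measure set 'rV[R]_n -> \bar R}.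

Let prodm : {measure set _ -> \bar R} := (@lebesgue_measure R \x mu)%E.

(* The library instance for this is shadowed by that on subprobabilities. *)
Let prodm_sigma_finite : sigma_finite setT prodm.
Proof.
have /sigma_finiteP[F [TF ndF Foo]] := sigma_finiteT (@lebesgue_measure R).
have /sigma_finiteP[G [TG ndG Goo]] := sigma_finiteT mu.
exists (fun k => F k `*` G k).
  rewrite -setXTT TF TG; apply/seteqP; split => [[x y]|[x y]].
    move=> [/= [i _ Fix] [j _ Gjy]]; exists (maxn i j) => //; split.
    - by move: x Fix; exact/subsetPset/ndF/leq_maxl.
    - by move: y Gjy; exact/subsetPset/ndG/leq_maxr.
  by move=> [i _ []/= ? ?]; split; exists i.
move=> k; have [? ?] := Foo k; have [? ?] := Goo k.
split; first exact: measurableX.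
rewrite (_ : prodm _ = lebesgue_measure (F k) * mu (G k)).
  by rewrite lte_mul_pinfty// ge0_fin_numE.
exact: product_measure1E.
Qed.

Let nu : set 'rV[R]_n.+1 -> \bar R := pushforward prodm (@rV_cons R n).

Let preim_cons (A : set 'rV[R]_n.+1) :
  measurable A -> measurable (@rV_cons R n @^-1` A).
Proof.
by move=> mA; rewrite -[X in measurable X]setTI; exact: measurable_rV_cons.
Qed.

Let nu0 : nu set0 = 0.
Proof. by rewrite /nu /pushforward preimage_set0 measure0. Qed.

Let nu_ge0 A : 0 <= nu A.
Proof. exact: (measure_ge0 prodm). Qed.

Let nu_sigma_additive : semi_sigma_additive nu.
Proof.
move=> F mF tF mUF; rewrite /nu /pushforward preimage_bigcup.
apply: measure_semi_sigma_additive.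
- by move=> k; exact: preim_cons.
- apply/trivIsetP => /= i j _ _ ij; rewrite -preimage_setI.
  by move/trivIsetP : tF => /(_ _ _ _ _ ij) ->//; rewrite preimage_set0.
- by rewrite -preimage_bigcup; exact: preim_cons.
Qed.

HB.instance Definition _ := isMeasure.Build _ _ _ nu
  nu0 nu_ge0 nu_sigma_additive.

Let uncons (x : 'rV[R]_n.+1) : (measurableTypeR R * 'rV[R]_n)%type :=
  (x ord0 ord0, \row_j x ord0 (lift ord0 j)).

Let m_uncons : measurable_fun setT uncons.
Proof.
apply: measurable_fun_pair; first exact: measurable_coord.
apply: measurable_fun_rV => i.
rewrite [X in measurable_fun _ X](_ : _ =
  (fun x : 'rV[R]_n.+1 => x ord0 (lift ord0 i) : measurableTypeR R)).
  exact: measurable_coord.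
by apply/funext => x; rewrite mxE.
Qed.

Let rV_consK : cancel (@rV_cons R n) uncons.
Proof.
move=> [x v]; rewrite /uncons /rV_cons /=; congr (_, _).
  rewrite (_ : ord0 = lshift n ord0 :> 'I_(1 + n)); last exact/val_inj.
  by rewrite (@row_mxEl _ 1 1 n) mxE eqxx mulr1n.
apply/rowP => j; rewrite mxE.
rewrite (_ : lift ord0 j = rshift 1 j :> 'I_(1 + n)); last exact/val_inj.
by rewrite (@row_mxEr _ 1 1 n).
Qed.

Let nu_sigma_finite : sigma_finite setT nu.
Proof.
have [F TF mF] := prodm_sigma_finite.
exists (fun k => uncons @^-1` F k); first by rewrite -preimage_bigcup -TF.
move=> k; have [mFk Fk_fin] := mF k; split.
  by rewrite -[X in measurable X]setTI; exact: m_uncons.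
rewrite /nu /pushforward -comp_preimage.
by rewrite (_ : uncons \o _ = id)//; apply/funext => z; exact: rV_consK.
Qed.

HB.instance Definition _ := Measure_isSigmaFinite.Build _ _ _ nu
  nu_sigma_finite.

Lemma lebesgue_rV_step :
  {nu' : {sigma_finite_measure set 'rV[R]_n.+1 -> \bar R} |
   nu' = pushforward (@lebesgue_measure R \x mu) (@rV_cons R n) :> (_ -> _)}.
Proof. by exists nu. Qed.

End lebesgue_rV_step.

Lemma lebesgue_rV_sigma_finite_measure (R : realType) (n : nat) :
  {mu : {sigma_finite_measure set 'rV[R]_n -> \bar R} |
   mu = @lebesgue_rV R n :> (_ -> _)}.
Proof.
elim: n => [|n [mu muE]].
  by exists (\d_(0 : 'rV[R]_0) : {sigma_finite_measure set 'rV[R]_0 -> \bar R}).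
have [nu nuE] := lebesgue_rV_step mu.
by exists nu; rewrite nuE /= -muE.
Qed.

Section lebesgue_rV_measure.
Local Open Scope ereal_scope.
Context (R : realType) (n : nat).

Let mu := sval (lebesgue_rV_sigma_finite_measure R n).
Let muE : mu = @lebesgue_rV R n :> (_ -> _).
Proof. exact: (svalP (lebesgue_rV_sigma_finite_measure R n)). Qed.

Let lebesgue_rV0 : @lebesgue_rV R n set0 = 0.
Proof. by rewrite -muE measure0. Qed.

Let lebesgue_rV_ge0 A : 0 <= @lebesgue_rV R n A.
Proof. by rewrite -muE measure_ge0. Qed.

Let lebesgue_rV_sigma_additive : semi_sigma_additive (@lebesgue_rV R n).
Proof. by rewrite -muE; exact: measure_semi_sigma_additive. Qed.

HB.instance Definition _ := isMeasure.Build _ _ _ (@lebesgue_rV R n)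
  lebesgue_rV0 lebesgue_rV_ge0 lebesgue_rV_sigma_additive.

Let lebesgue_rV_sigma_finite : sigma_finite setT (@lebesgue_rV R n).
Proof. by rewrite -muE; exact: sigma_finiteT. Qed.

HB.instance Definition _ := Measure_isSigmaFinite.Build _ _ _
  (@lebesgue_rV R n) lebesgue_rV_sigma_finite.

End lebesgue_rV_measure.

Lemma lebesgue_rV_box (R : realType) (n : nat) (a b : 'rV[R]_n) :
  (forall i, a ord0 i <= b ord0 i) ->
  lebesgue_rV [set x : 'rV[R]_n | forall i, x ord0 i \in `[a ord0 i, b ord0 i]]
  = (\prod_(i < n) (b ord0 i - a ord0 i))%:E.
Proof.
elim: n a b => [|n IH] a b ab /=.
  by rewrite big_ord0 diracE mem_set// => -[].
pose tl (x : 'rV[R]_n.+1) : 'rV[R]_n := \row_j x ord0 (lift ord0 j).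
pose B := [set x : 'rV[R]_n |
  forall i, x ord0 i \in `[tl a ord0 i, tl b ord0 i]].
have mB : measurable B.
  rewrite (_ : B = \bigcap_(i in [set: 'I_n])
      ((fun x : 'rV[R]_n => x ord0 i : measurableTypeR R) @^-1`
        `[tl a ord0 i, tl b ord0 i]%classic)); last first.
    apply/seteqP; split => [x Bx i _|x Bx i]; first exact: Bx.
    exact: (Bx i).
  apply: fin_bigcap_measurable; first exact: finite_finset.
  move=> i _; rewrite -[X in measurable X]setTI.
  by apply: measurable_coord => //; exact: measurable_itv.
rewrite /pushforward [X in (_ \x _)%E X](_ : _ =
    `[a ord0 ord0, b ord0 ord0]%classic `*` B); last first.
  have e0 (z : measurableTypeR R * 'rV[R]_n) : rV_cons z ord0 ord0 = z.1.
    rewrite /rV_cons (_ : ord0 = lshift n ord0 :> 'I_(1 + n)); last exact/val_inj.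
    by rewrite (@row_mxEl _ 1 1 n) mxE eqxx mulr1n.
  have eS (z : measurableTypeR R * 'rV[R]_n) j :
      rV_cons z ord0 (lift ord0 j) = z.2 ord0 j.
    rewrite /rV_cons.
    rewrite (_ : lift ord0 j = rshift 1 j :> 'I_(1 + n)); last exact/val_inj.
    by rewrite (@row_mxEr _ 1 1 n).
  apply/seteqP; split => [z /= zab|z /= [z0 zS] i].
    split; first by rewrite -e0; exact: zab.
    by move=> j; rewrite !mxE -eS; exact: zab.
  have [j ->|->] := unliftP ord0 i; last by rewrite e0.
  by rewrite eS; have := zS j; rewrite !mxE.
transitivity (lebesgue_measure `[a ord0 ord0, b ord0 ord0]%classic *
    lebesgue_rV B)%E.
  exact: (product_measure1E (@lebesgue_measure R) (@lebesgue_rV R n)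
    (measurable_itv _) mB).
rewrite IH; last by move=> i; rewrite !mxE.
rewrite lebesgue_measure_itv/= lte_fin -[X in (X * _)%E](_ : (b ord0 ord0 - a ord0 ord0)%:E = _); last first.
  by case: ltgtP (ab ord0) => // -> _; rewrite subrr.
rewrite -EFinM big_ord_recl; congr (_ * _)%:E.
by apply: eq_bigr => i _; rewrite !mxE.
Qed.

Definition sphere (R : realType) (n : nat) : set 'rV[R]_n.+1 :=
  [set u | enorm u = 1].

(* Lebesgue measure of a subset E of the unit sphere of R^(n+1), obtained from
   polar coordinates: the cone {r u | 0 <= r <= 1, u in E} has volume
   \int_0^1 r^n sigma_n(E) dr = sigma_n(E) / (n+1). *)
Definition sphere_measure (R : realType) (n : nat) (E : set 'rV[R]_n.+1) :
    \bar R :=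
  (n.+1%:R%:E *
   lebesgue_rV [set (r *: u : 'rV[R]_n.+1) | r in `[0%R, 1%R] & u in E])%E.

Definition pmean (R : realType) (p : \bar R) (a b l : R) : R :=
  if a * b == 0 then 0 else
  match p with
  | r%:E => if r == 0 then a `^ (1 - l) * b `^ l
            else ((1 - l) * a `^ r + l * b `^ r) `^ r^-1
  | +oo%E => Num.max a b
  | -oo%E => Num.min a b
  end.

Definition p_concave (R : realType) (n : nat) (p : \bar R) (A : set 'rV[R]_n)
    (f : 'rV[R]_n -> R) : Prop :=
  [/\ convex_set A,
      forall x, A x -> 0 <= f x &
      forall (x0 x1 : 'rV[R]_n) (l : R), A x0 -> A x1 -> 0 <= l <= 1 ->
        pmean p (f x0) (f x1) l <= f ((1 - l) *: x0 + l *: x1)].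

Definition strictly_p_concave (R : realType) (n : nat) (p : \bar R)
    (A : set 'rV[R]_n) (f : 'rV[R]_n -> R) : Prop :=
  p_concave p A f /\
  forall (x0 x1 : 'rV[R]_n) (l : R), A x0 -> A x1 -> x0 != x1 -> 0 < l < 1 ->
    pmean p (f x0) (f x1) l < f ((1 - l) *: x0 + l *: x1).

(* q / (1 - q), with -1 at q = +oo and -oo at q = 1; the value at -oo is
   irrelevant. *)
Definition concavity_exponent (R : realType) (q : \bar R) : \bar R :=
  match q with
  | r%:E => if r == 1 then -oo%E else (r / (1 - r))%:E
  | +oo%E => (-1)%:E
  | -oo%E => (-1)%:E
  end.

(* For a nonnegative integrand the library integral is the supremum of the
   integrals of the Borel simple functions below it, so it is the usual
   Lebesgue integral for every Lebesgue-measurable g, Borel or not. *)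
Definition poisson (R : realType) (n : nat) (g : 'rV[R]_n -> R)
    (x : 'rV[R]_n) (t : R) : \bar R :=
  ((2 * t / fine (sphere_measure (@sphere R n)))%:E *
   \int[@lebesgue_rV R n]_y
     ((enorm (x - y) ^+ 2 + t ^+ 2) `^ (- (n.+1%:R / 2)) * g y)%:E)%E.

(* Main.v *)
(* Write [kappa = 1/q] and [gamma = n + 1]. The kernel is [k ^ (- gamma)] with
   [k = sqrt (|x - y|^2 + t^2)] convex, so by Hölder's inequality for means the
   integrand [k ^ (- gamma) * g] is [- 1 / (gamma - kappa)]-concave jointly in
   [(x, y)]; the Borell-Brascamp-Lieb inequality turns this into
   [- 1 / (1 - kappa) = q / (1 - q)]-concavity of the integral. For the latter,
   the one-dimensional case follows from the Brunn-Minkowski inequality on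
   superlevel sets after normalising suprema, and the general case from Fubini.
   Strictness needs no equality case: [k] is strictly convex except along
   [y1 - y0 = x1 - x0], and since the support of [g] is bounded it contains a
   cube none of whose points is a combination of such [y0], [y1] in the support.
   Over that cube the integrand can be lowered by a constant factor without
   violating the hypothesis of the inequality.
   The function [g] may fail to be Borel on the boundary of its support, which
   is shown to be negligible. *)
Require Import Defs.
From HB Require Import structures.
From mathcomp Require Import all_boot all_order all_algebra.
From mathcomp Require Import all_classical all_reals all_analysis.
From mathcomp Require Import measurable_realfun ring lra.

Set Implicit Arguments.
Unset Strict Implicit.
Unset Printing Implicit Defensive.

Import Order.TTheory GRing.Theory Num.Theory.
Import numFieldNormedType.Exports.

Local Open Scope classical_set_scope.
Local Open Scope ring_scope.

(** * Means *)

(** Concavity of [g] holds on its support only, because [pmean q] vanishes as soon as one of the two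
    values does: [g] may jump at the boundary of the support. Indexing means by [alpha], for the
    exponent [- 1 / alpha], makes the bookkeeping linear. The kernel contributes [n + 1], [g]
    contributes [- kappa], each integrated coordinate costs 1, and [1 - kappa] is left, which is
    nonnegative when [q >= 1]. The integral inequality is stated for three separate functions, here
    the integrands at [x0], [x1] and at their combination, so that the third can be lowered alone.
    Lowering it by a constant factor requires a uniform convexity gain for [k]; this follows from an
    upper bound on the norms and a lower bound on the distance between [y1 - y0] and [x1 - x0].
    Boundedness of the support supplies both. *)

Lemma ler_powR_npos (R : realType) (x y r : R) :
  0 < x -> x <= y -> r <= 0 -> y `^ r <= x `^ r.
Proof.
move=> x0 xy r0; rewrite -[r]opprK !(powRN _ (- r)).
rewrite lef_pV2 ?posrE ?powR_gt0 ?(lt_le_trans x0)//.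
by apply: ge0_ler_powR; rewrite ?oppr_ge0 ?nnegrE// ltW// (lt_le_trans x0).
Qed.

Section means.
Variables (R : realType) (l : R).
Hypothesis l01 : 0 < l < 1.

Let l0 : 0 < l. Proof. by case/andP: l01. Qed.
Let m0 : 0 < 1 - l. Proof. by rewrite subr_gt0; case/andP: l01. Qed.

Lemma wsum_gt0 (a b : R) : 0 < a -> 0 < b -> 0 < (1 - l) * a + l * b.
Proof. by move=> a0 b0; rewrite addr_gt0// mulr_gt0. Qed.

(* Joint convexity of [(X, U) |-> X ^ a * U ^ (1 - a)], the perspective of the
   convex function [x ^ a]. *)
Lemma perspective_powR (a X Y U V : R) : 1 <= a ->
  0 < X -> 0 < Y -> 0 < U -> 0 < V ->
  ((1 - l) * X + l * Y) `^ a * ((1 - l) * U + l * V) `^ (1 - a) <=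
  (1 - l) * (X `^ a * U `^ (1 - a)) + l * (Y `^ a * V `^ (1 - a)).
Proof.
move=> a1 X0 Y0 U0 V0; set W := (1 - l) * U + l * V.
have W0 : 0 < W by exact: wsum_gt0.
have scale Z T : 0 < Z -> 0 < T -> Z `^ a * T `^ (1 - a) = T * (Z / T) `^ a.
  move=> Z0 T0; rewrite powRM ?invr_ge0 ?ltW// powRD; last first.
    by rewrite (gt_eqF T0) implybT.
  rewrite powRr1 ?ltW// -powR_inv1 ?ltW// -powRrM mulN1r.
  by rewrite mulrCA.
have S0 : 0 < (1 - l) * X + l * Y by exact: wsum_gt0.
rewrite !scale//.
(* Jensen's inequality for [x ^ a] at the points [X / U] and [Y / V], with weights proportional to
   [(1 - l) * U] and [l * V]. *)
pose t := (1 - l) * U / W.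
have t0 : 0 <= t by rewrite divr_ge0 ?mulr_ge0// ltW.
have tE : 1 - t = l * V / W.
  by rewrite /t -[X in X - _](mulfV (lt0r_neq0 W0)) -mulrBl /W addrC addKr.
have t1 : t <= 1 by rewrite -subr_ge0 tE divr_ge0 ?mulr_ge0// ltW.
have := @convex_powR R a a1 (Itv01 t0 t1) (X / U) (Y / V).
rewrite !inE/= !in_itv/= !andbT => /(_ (ltW (divr_gt0 X0 U0))).
move=> /(_ (ltW (divr_gt0 Y0 V0))).
rewrite convRE [X in X `^ _ <= _]convRE /= /unstable.onem tE.
rewrite [X in X `^ _](_ : _ = ((1 - l) * X + l * Y) / W); last first.
  by rewrite /t; field; rewrite !lt0r_neq0.
rewrite -(ler_pM2l W0) => /le_trans; apply.
rewrite le_eqVlt; apply/orP; left; apply/eqP; rewrite /t; field.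
exact: lt0r_neq0.
Qed.

(* The mean with exponent [- 1 / alpha]; [alpha = 0] is the exponent [-oo].
   In terms of [alpha], Hölder's inequality for means is additive. *)
Definition inv_mean (alpha a b : R) : R :=
  if alpha == 0 then Num.min a b else
  ((1 - l) * a `^ (- alpha^-1) + l * b `^ (- alpha^-1)) `^ (- alpha).

Lemma inv_mean_gt0 (alpha a b : R) : 0 < a -> 0 < b -> 0 < inv_mean alpha a b.
Proof.
move=> a0 b0; rewrite /inv_mean; case: ifPn => [_|_].
  by rewrite lt_min a0.
by rewrite powR_gt0// wsum_gt0// powR_gt0.
Qed.

Lemma ler_inv_mean (alpha a b c d : R) : 0 <= alpha -> 0 < a -> 0 < b ->
  a <= c -> b <= d -> inv_mean alpha a b <= inv_mean alpha c d.
Proof.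
move=> al0 a0 b0 ac bd; rewrite /inv_mean; case: ifPn => [_|_].
  by rewrite le_min !ge_min ac bd orbT.
have ai : - alpha^-1 <= 0 by rewrite oppr_le0 invr_ge0.
apply: ler_powR_npos; rewrite ?oppr_le0//.
  by rewrite wsum_gt0// powR_gt0 ?(lt_le_trans a0 ac) ?(lt_le_trans b0 bd).
by rewrite lerD// ler_pM2l// ler_powR_npos.
Qed.

Lemma inv_meanZ (alpha k a b : R) : 0 <= alpha -> 0 < k -> 0 < a -> 0 < b ->
  inv_mean alpha (k * a) (k * b) = k * inv_mean alpha a b.
Proof.
move=> al0 k0 a0 b0; rewrite /inv_mean; case: ifPn => [_|al].
  by rewrite -minr_pMr// ltW.
rewrite !powRM ?ltW// (mulrCA (1 - l)) (mulrCA l) -mulrDr powRM ?powR_ge0//.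
  by rewrite -powRrM mulrNN mulVf// powRr1// ltW.
by rewrite ltW// wsum_gt0// powR_gt0.
Qed.

(** Hölder's inequality for the parameters [alpha] and [-1], the latter being the arithmetic mean.
    It accounts for the loss of 1 in [alpha] per integration. *)
Lemma inv_meanM (alpha A B a b : R) : 1 <= alpha ->
  0 < A -> 0 < B -> 0 < a -> 0 < b ->
  inv_mean (alpha - 1) (A * a) (B * b) <=
  inv_mean alpha A B * ((1 - l) * a + l * b).
Proof.
move=> al1 A0 B0 a0 b0.
have al0 : 0 < alpha by exact: lt_le_trans al1.
rewrite {2}/inv_mean (gt_eqF al0); have [->|alN1] := eqVneq alpha 1.
  have S0 : 0 < (1 - l) / A + l / B by rewrite wsum_gt0 ?invr_gt0.
  rewrite subrr /inv_mean eqxx invr1 (powR_inv1 (ltW A0)) (powR_inv1 (ltW B0)).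
  rewrite (powR_inv1 (ltW S0)) [leRHS]mulrC ler_pdivlMr// mulrDr.
  set m := Num.min _ _.
  have mA : m / A <= a by rewrite ler_pdivrMr// mulrC /m ge_min lexx.
  have mB : m / B <= b by rewrite ler_pdivrMr// mulrC /m ge_min lexx orbT.
  by rewrite (mulrCA m) (mulrCA m l) lerD// ler_pM2l.
have be0 : 0 < alpha - 1 by rewrite subr_gt0 lt_neqAle eq_sym alN1.
rewrite /inv_mean (gt_eqF be0).
(* The arguments given to [perspective_powR] are chosen so that each term on its right-hand side
   collapses to [a] or [b]. *)
have pull C c : 0 < C -> 0 < c ->
    (C `^ (- alpha^-1)) `^ alpha *
    ((C * c) `^ (- (alpha - 1)^-1)) `^ (1 - alpha) = c.
  move=> C0 c0; rewrite -!powRrM mulNr mulVf ?gt_eqF// -(opprB alpha) mulrNN.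
  rewrite mulVf ?gt_eqF// powRr1; last by rewrite ltW// mulr_gt0.
  by rewrite powR_inv1 ?ltW// mulKf// gt_eqF.
have P C c r : 0 < C -> 0 < c -> 0 < (C * c) `^ r.
  by move=> C0 c0; rewrite powR_gt0// mulr_gt0.
have := @perspective_powR alpha (A `^ (- alpha^-1)) (B `^ (- alpha^-1))
  ((A * a) `^ (- (alpha - 1)^-1)) ((B * b) `^ (- (alpha - 1)^-1)) al1.
move=> /(_ (powR_gt0 _ A0) (powR_gt0 _ B0) (P _ _ _ _ A0 a0) (P _ _ _ _ B0 b0)).
rewrite !pull// opprB; set S := _ + l * B `^ _; set W := _ + l * _ `^ _.
have S0 : 0 < S by rewrite wsum_gt0// powR_gt0.
rewrite powRN ler_pdivlMl//.
exact: powR_gt0.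
Qed.

(** Hölder's inequality for the parameters [gamma] and [- kappa]: the first factor on the right is
    [inv_mean gamma] of the values [k ^ (- gamma)]. *)
Lemma inv_mean_ratio (gamma kappa k0 k1 g0 g1 : R) :
  0 <= kappa -> 1 <= gamma -> kappa < gamma ->
  0 < k0 -> 0 < k1 -> 0 < g0 -> 0 < g1 ->
  inv_mean (gamma - kappa) (k0 `^ (- gamma) * g0) (k1 `^ (- gamma) * g1) <=
  ((1 - l) * k0 + l * k1) `^ (- gamma) *
  (if kappa == 0 then Num.max g0 g1
   else ((1 - l) * g0 `^ kappa^-1 + l * g1 `^ kappa^-1) `^ kappa).
Proof.
move=> ka0 ga1 kaga k00 k10 g00 g10.
have ga0 : 0 < gamma by exact: lt_le_trans ga1.
have [->|kaN0] := eqVneq kappa 0.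
  have x0 : 0 < Num.max g0 g1 by rewrite lt_max g00.
  rewrite subr0 [leRHS]mulrC.
  have -> : ((1 - l) * k0 + l * k1) `^ (- gamma) =
      inv_mean gamma (k0 `^ (- gamma)) (k1 `^ (- gamma)).
    rewrite /inv_mean (gt_eqF ga0) -!powRrM mulrNN mulfV ?gt_eqF//.
    by rewrite !powRr1// ltW.
  rewrite -inv_meanZ ?powR_gt0 ?(ltW ga0)//.
  apply: ler_inv_mean; rewrite ?mulr_gt0 ?powR_gt0 ?(ltW ga0)//.
    by rewrite mulrC ler_pM2r ?powR_gt0// le_max lexx.
  by rewrite mulrC ler_pM2r ?powR_gt0// le_max lexx orbT.
have {kaN0}ka0 : 0 < kappa by rewrite lt_neqAle eq_sym kaN0.
have al0 : 0 < gamma - kappa by rewrite subr_gt0.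
rewrite /inv_mean (gt_eqF al0).
(* With this exponent, [(k ^ (- gamma) * g) ^ (- 1 / (gamma - kappa))] is the perspective of
   [x ^ be] at [k] and [g ^ (1 / kappa)]; the negative power [- (gamma - kappa)] then reverses the
   convexity inequality. *)
set be := gamma / (gamma - kappa).
have be1 : 1 <= be by rewrite ler_pdivlMr// mul1r gerBl ltW.
have beE : 1 - be = - kappa / (gamma - kappa).
  by rewrite /be; field; rewrite gt_eqF.
have pull k g : 0 < k -> 0 < g -> (k `^ (- gamma) * g) `^ (- (gamma - kappa)^-1)
    = k `^ be * (g `^ kappa^-1) `^ (1 - be).
  move=> k_gt0 g_gt0; rewrite powRM ?powR_ge0 ?ltW// -!powRrM mulrNN; congr (_ * _).
  by rewrite beE mulrA mulrN mulVf ?gt_eqF// mulN1r.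
rewrite !pull//.
have := perspective_powR be1 k00 k10 (powR_gt0 kappa^-1 g00)
  (powR_gt0 kappa^-1 g10).
set Q := (X in _ <= X) => PQ.
set S := _ + l * k1; set G := _ + l * g1 `^ _.
have S0 : 0 < S by exact: wsum_gt0.
have G0 : 0 < G by rewrite wsum_gt0// powR_gt0.
have -> : S `^ (- gamma) * G `^ kappa =
    (S `^ be * G `^ (1 - be)) `^ (- (gamma - kappa)).
  rewrite powRM ?powR_ge0// -!powRrM; congr (_ `^ _ * _ `^ _).
    by rewrite /be; field; rewrite gt_eqF.
  by rewrite beE; field; rewrite gt_eqF.
by apply: ler_powR_npos; rewrite ?mulr_gt0 ?powR_gt0// oppr_le0 ltW.
Qed.

End means.

(** * The Borell-Brascamp-Lieb inequality *)

Section brunn_minkowski_line.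
Context {R : realType}.
Local Notation mu := (@lebesgue_measure R).

Lemma measurable_affine (c d : R) : measurable_fun [set: measurableTypeR R]
  ((fun x => (x - d) / c) : measurableTypeR R -> measurableTypeR R).
Proof.
by apply: measurable_funM => //; apply: measurable_funB.
Qed.

Lemma lebesgue_measure_affine (c d : R) (A : set (measurableTypeR R)) :
  0 < c -> measurable A -> mu [set x | A ((x - d) / c)] = (c%:E * mu A)%E.
Proof.
move=> c0 mA; pose f : measurableTypeR R -> measurableTypeR R :=
  fun x => (x - d) / c.
have ci0 : 0 <= c^-1 by rewrite invr_ge0 ltW.
have : mu A = mscale (NngNum ci0)
    (measure_function_pushforward__canonical__measure_function_Measure
       mu (measurable_affine c d)) A.
  apply: lebesgue_measure_unique => // _ [[a b] _ <-] /=.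
  have E : (fun x => (x - d) / c) @^-1` `]a, b] = `]c * a + d, c * b + d]%classic.
    apply/seteqP; split => x; rewrite /= !in_itv/= ltr_pdivlMr// ler_pdivrMr//.
      by rewrite ltrBrDr lerBlDr mulrC (mulrC b).
    by rewrite ltrBrDr lerBlDr mulrC (mulrC b).
  pose J : set (measurableTypeR R) := `]c * a + d, c * b + d]%classic.
  transitivity (c^-1%:E * mu J)%E; last by rewrite /J -E.
  rewrite /J.
  rewrite !lebesgue_measure_itv/= !lte_fin ltrD2r ltr_pM2l//.
  case: ifPn => // _; last by rewrite mule0.
  rewrite -EFinB -EFinD -EFinM; congr EFin; field.
  by rewrite gt_eqF.
rewrite /mscale /pushforward /= => ->.
by rewrite muleA -EFinM mulfV ?gt_eqF// mul1e.
Qed.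

(** Continuity from below. The cut-offs are points of [A] because only these can be paired with
    points of a second set in [brunn_minkowski_line]. *)
Lemma lebesgue_measure_le_below (A : set (measurableTypeR R)) (M : \bar R) :
  measurable A -> A !=set0 ->
  (forall a, A a -> (mu (A `&` `]-oo, a]%classic) <= M)%E) -> (mu A <= M)%E.
Proof.
move=> mA A0 AM.
have [[a [Aa aub]]|nomax] := pselect (exists a, A a /\ ubound A a).
  rewrite (_ : A = A `&` `]-oo, a]%classic); first exact: AM.
  apply/seteqP; split => [x Ax|x []//]; split => //=.
  by rewrite in_itv/=; exact: aub.
have bigger a : A a -> exists2 b, A b & a < b.
  move=> Aa; apply: contrapT => nob; apply: nomax; exists a; split => // x Ax.
  by rewrite leNgt; apply/negP => ax; apply: nob; exists x.
(* Without a maximum every point of [A] lies strictly below [sup A], so cut-offs increasing to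
   [sup A], or to infinity, exhaust [A]. *)
have [c [cnd cA Ac]] : exists c : nat -> R,
    [/\ {homo c : m n / (m <= n)%N >-> m <= n},
        forall n, exists2 a, A a & c n <= a &
        forall x, A x -> exists n, x <= c n].
  have [ub|nub] := pselect (has_ubound A).
    exists (fun n => sup A - n.+1%:R^-1); split.
    - by move=> m n mn; rewrite lerB// lef_pV2 ?posrE// ler_nat.
    - move=> n; have := @sup_adherent _ A n.+1%:R^-1.
      case=> [||a Aa /ltW sa]; last by exists a.
        by rewrite invr_gt0.
      by split.
    - move=> x /bigger[y Ay xy]; have yS : y <= sup A by exact: ub_le_sup.
      have xS : 0 < sup A - x by rewrite subr_gt0 (lt_le_trans xy).
      exists (Num.truncn (sup A - x)^-1).
      rewrite lerBrDl -lerBrDr -[leRHS]invrK lef_pV2 ?posrE ?invr_gt0//.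
      exact/ltW/truncnS_gt.
  exists (fun n => n%:R); split.
  - by move=> m n mn; rewrite ler_nat.
  - move=> n; apply: contrapT => nob; apply: nub; exists n%:R => x Ax.
    by rewrite leNgt; apply/negP => nx; apply: nob; exists x => //; exact: ltW.
  - move=> x _; exists (Num.truncn x).+1; exact/ltW/truncnS_gt.
have UE : \bigcup_n (A `&` `]-oo, c n]%classic) = A.
  apply/seteqP; split => [x [n _ []]//|x Ax].
  by have [n xn] := Ac _ Ax; exists n => //; split => //=.
have mF n : measurable (A `&` `]-oo, c n]%classic).
  by apply: measurableI => //; exact: measurable_itv.
have Fnd : nondecreasing_seq (fun n => A `&` `]-oo, c n]%classic).
  move=> m n mn; apply/subsetPset => x [Ax] /=; rewrite in_itv/= => xm.
  by split => //=; rewrite in_itv/= (le_trans xm)// cnd.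
have cv : (mu \o (fun n => A `&` `]-oo, c n]%classic)) n @[n --> \oo] --> mu A.
  by rewrite -{2}UE; apply: nondecreasing_cvg_mu => //; rewrite UE.
have /cvg_lim <- // := cv.
apply: lime_le; first by apply/cvg_ex; exists (mu A).
near=> n; have [a Aa na] := cA n; apply: le_trans (AM _ Aa).
apply: le_measure; rewrite ?inE//.
  by apply: measurableI => //; exact: measurable_itv.
move=> x [Ax] /=; rewrite in_itv/= => xm; split => //=.
by rewrite in_itv/= (le_trans xm).
Unshelve. all: by end_near. Qed.

Lemma lebesgue_measure_le_above (A : set (measurableTypeR R)) (M : \bar R) :
  measurable A -> A !=set0 ->
  (forall a, A a -> (mu (A `&` `[a, +oo[%classic) <= M)%E) -> (mu A <= M)%E.
Proof.
move=> mA [a0 Aa0] AM; rewrite -lebesgue_measureN// /pushforward.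
have mN : measurable ((-%R : _ -> measurableTypeR R) @^-1` A).
  by rewrite -[X in measurable X]setTI; exact: measurable_funN.
apply: lebesgue_measure_le_below => //.
  by exists (- a0); rewrite /= opprK.
move=> a Aa; have := AM _ Aa; rewrite -lebesgue_measureN; last first.
  by apply: measurableI => //; exact: measurable_itv.
rewrite /pushforward /= (_ : _ @^-1` (_ `&` _) =
    (-%R : _ -> measurableTypeR R) @^-1` A `&` `]-oo, a]%classic)//.
by apply/seteqP; split => x [Ax] /=; rewrite !in_itv/= andbT lerN2.
Qed.

(* No compactness is needed: for [a] in [A] and [b] in [B] the parts of [A]
   below [a] and of [B] above [b] are placed side by side in [C]. *)
Lemma brunn_minkowski_line (l : R) (A B C : set (measurableTypeR R)) :
  0 < l < 1 -> measurable A -> measurable B -> measurable C ->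
  A !=set0 -> B !=set0 ->
  (forall x y, A x -> B y -> C ((1 - l) * x + l * y)) ->
  ((1 - l)%:E * mu A + l%:E * mu B <= mu C)%E.
Proof.
move=> /andP[l0 l1] mA mB mC A0 B0 ABC.
have m0 : 0 < 1 - l by rewrite subr_gt0.
have [->|muC] := eqVneq (mu C) +oo%E; first exact: leey.
have finC : mu C \is a fin_num by rewrite ge0_fin_numE// ltey.
have side a b : A a -> B b ->
    ((1 - l)%:E * mu (A `&` `]-oo, a]%classic) +
     l%:E * mu (B `&` `[b, +oo[%classic) <= mu C)%E.
  move=> Aa Bb.
  have mAa : measurable (A `&` `]-oo, a]%classic).
    by apply: measurableI => //; exact: measurable_itv.
  have mBb : measurable (B `&` `[b, +oo[%classic).
    by apply: measurableI => //; exact: measurable_itv.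
  rewrite -(lebesgue_measure_affine (l * b) m0 mAa).
  rewrite -(lebesgue_measure_affine ((1 - l) * a) l0 mBb).
  set P := [set x | _]; set Q := [set x | _].
  have mP : measurable P.
    by rewrite -[X in measurable X]setTI; exact: measurable_affine.
  have mQ : measurable Q.
    by rewrite -[X in measurable X]setTI; exact: measurable_affine.
  (* [P] lies to the left of [c] and [Q] to the right, so they share at most this null point, which
     is removed from [Q]. *)
  pose c : R := (1 - l) * a + l * b.
  have Pc : P `<=` `]-oo, c]%classic.
    move=> x [_] /=; rewrite !in_itv/= ler_pdivrMr// lerBlDr.
    by rewrite mulrC.
  have Qc : Q `<=` `[c, +oo[%classic.
    move=> x [_] /=; rewrite !in_itv/= !andbT ler_pdivlMr// lerBrDr.
    by rewrite addrC (mulrC b).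
  have QQ : mu Q = mu (Q `\ c).
    rewrite measureD//= ?(_ : Q `&` [set c] = Q `&` [set c])//.
      rewrite (@subset_measure0 _ _ _ mu (Q `&` [set c]) [set c])//.
      - by rewrite sube0.
      - exact: measurableI.
      - exact: lebesgue_measure_set1.
    apply: le_lt_trans (_ : mu C < +oo)%E; last by rewrite -ge0_fin_numE.
    apply: le_measure; rewrite ?inE// => x [Bx _].
    rewrite (_ : x = (1 - l) * a + l * ((x - (1 - l) * a) / l)); first exact: ABC.
    by field; rewrite gt_eqF.
  rewrite QQ -measureU//.
  - apply: le_measure; rewrite ?inE//.
      by apply: measurableU => //; exact: measurableD.
    move=> x [[Ax _]|[[Bx _] _]].
      rewrite (_ : x = (1 - l) * ((x - l * b) / (1 - l)) + l * b); first exact: ABC.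
      by field; rewrite gt_eqF.
    rewrite (_ : x = (1 - l) * a + l * ((x - (1 - l) * a) / l)); first exact: ABC.
    by field; rewrite gt_eqF.
  - exact: measurableD.
  - apply/seteqP; split => // x [/Pc/= xc [/Qc/= cx]]; apply.
    move: xc cx; rewrite !in_itv/= andbT => xc cx.
    by apply/eqP; rewrite eq_le xc.
have [a1 Aa1] := A0; have [b1 Bb1] := B0.
have fin0 k (D : set (measurableTypeR R)) z : 0 < k -> (0 <= z)%E ->
    (k%:E * mu D + z <= mu C)%E -> z \is a fin_num.
  move=> k0 z0 H; rewrite ge0_fin_numE// (le_lt_trans _ (_ : mu C < +oo)%E)//.
    by apply: le_trans H; rewrite leeDr// mule_ge0// lee_fin ltW.
  by rewrite -ge0_fin_numE.
have step1 b : B b -> ((1 - l)%:E * mu A +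
     l%:E * mu (B `&` `[b, +oo[%classic) <= mu C)%E.
  move=> Bb; have z0 : (0 <= l%:E * mu (B `&` `[b, +oo[%classic))%E.
    by rewrite mule_ge0// lee_fin ltW.
  have zf := fin0 _ _ _ m0 z0 (side _ _ Aa1 Bb).
  rewrite -leeBrDr// -lee_pdivlMl//.
  apply: lebesgue_measure_le_below => // a Aa.
  by rewrite lee_pdivlMl// leeBrDr//; exact: side.
have z0 : (0 <= (1 - l)%:E * mu A)%E by rewrite mule_ge0// lee_fin ltW.
have zf : ((1 - l)%:E * mu A)%E \is a fin_num.
  by apply: (fin0 l _ _ l0 z0); rewrite addeC; exact: step1 Bb1.
rewrite addeC -leeBrDr// -lee_pdivlMl//.
apply: lebesgue_measure_le_above => // b Bb.
by rewrite lee_pdivlMl// leeBrDr// addeC; exact: step1.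
Qed.

End brunn_minkowski_line.

Lemma measurable_set_ltr d (T : measurableType d) (R : realType)
    (f g : T -> R) :
  measurable_fun setT f -> measurable_fun setT g ->
  measurable [set x | f x < g x].
Proof.
move=> mf mg; rewrite -[X in measurable X]setTI.
have := @measurable_lte _ T R setT measurableT (EFin \o f) (EFin \o g).
move=> /(_ (measurableT_comp _ mf)) /(_ (measurableT_comp _ mg)).
by under [X in setT `&` X]eq_set do rewrite /= lte_fin; exact.
Qed.

(** * The one-dimensional inequality by superlevel sets *)

Section bbl_line.
Context {R : realType}.
Local Notation mu := (@lebesgue_measure R).
Local Notation MR := (measurableTypeR R).

(** The part of the hypograph in the strip between heights 0 and 1. This strip contains everything
    relevant for normalised functions, and truncating [h] at height 1 only lowers its integral. *)
Let levels (f : MR -> R) : set (MR * MR)%type :=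
  [set z | 0 < z.2] `&` [set z | z.2 < 1] `&` [set z | z.2 < f z.1].

Let measurable_levels (f : MR -> R) : measurable_fun setT f -> measurable (levels f).
Proof.
move=> mf; apply: measurableI; first apply: measurableI.
- exact: (@measurable_set_ltr _ _ R (cst 0) snd).
- exact: (@measurable_set_ltr _ _ R snd (cst 1)).
- apply: (@measurable_set_ltr _ _ R snd (f \o fst)) => //.
  exact: measurableT_comp.
Qed.

Let level (f : MR -> R) (t : R) : \bar R :=
  mu [set x | 0 < t < 1 /\ t < f x].

Let mset_level (f : MR -> R) t : measurable_fun setT f ->
  measurable ([set x | 0 < t < 1 /\ t < f x] : set MR).
Proof.
move=> mf; have [t01|t01] := boolP (0 < t < 1); last first.
  rewrite (_ : [set x | _] = set0)//.
  by apply/seteqP; split => x //= -[].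
rewrite (_ : [set x | _] = [set x | t < f x]).
  exact: (@measurable_set_ltr _ _ R (cst t)).
by apply/seteqP; split => x //= -[].
Qed.

Let levelE (f : MR -> R) t : measurable_fun setT f ->
  level f t = (\int[mu]_x (\1_(levels f) (x, t))%:E)%E.
Proof.
move=> mf.
rewrite (eq_integral (fun x => (\1_[set x | 0 < t < 1 /\ t < f x] x)%:E)).
  by rewrite integral_indic ?setIT//; exact: mset_level.
move=> x _; rewrite !indicE; congr (_%:R%:E); congr nat_of_bool.
apply/idP/idP; rewrite !inE /levels/=.
  by move=> [[-> ->] ->].
by move=> [/andP[-> ->] ->].
Qed.

Let measurable_level (f : MR -> R) :
  measurable_fun setT f -> measurable_fun setT (level f).
Proof.
move=> mf; rewrite (_ : level f = fun t => (\int[mu]_x (\1_(levels f) (x, t))%:E)%E).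
  apply: (@measurable_fun_fubini_tonelli_G _ _ _ _ R mu (fun z => (\1_(levels f) z)%:E)).
    by apply: measurableT_comp => //; exact: measurable_indic (measurable_levels mf).
  by move=> z; rewrite lee_fin.
by apply/funext => t; exact: levelE.
Qed.

(** Layer-cake formula: Tonelli's theorem for the indicator of [levels f]. *)
Let integral_level (f : MR -> R) : measurable_fun setT f -> (forall x, 0 <= f x) ->
  (\int[mu]_t level f t = \int[mu]_x (Num.min (f x) 1)%:E)%E.
Proof.
move=> mf f0.
rewrite (eq_integral (fun t => (\int[mu]_x (\1_(levels f) (x, t))%:E)%E)); last first.
  by move=> t _; exact: levelE.
rewrite -(@fubini_tonelli _ _ _ _ R mu mu (fun z => (\1_(levels f) z)%:E)).
- apply: eq_integral => x _.
  rewrite (eq_integral (fun t => (\1_(`]0, Num.min (f x) 1[%classic : set MR) t)%:E)).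
    rewrite integral_indic//.
    rewrite setIT; have := @lebesgue_measure_itv R `]0, Num.min (f x) 1[.
    rewrite /= lte_fin lt_min ltr01 andbT => ->.
    by case: ltP; [rewrite oppr0 adde0|] => // fx0; congr EFin;
      apply/eqP; rewrite eq_le ge_min fx0 le_min f0 ler01.
  move=> t _; rewrite !indicE; congr (_%:R%:E); congr nat_of_bool.
  apply/idP/idP; rewrite !inE /levels/= in_itv/= lt_min.
    by move=> [[-> ->] ->].
  by move=> /and3P[-> -> ->].
- by apply: measurableT_comp => //; exact: measurable_indic (measurable_levels mf).
- by move=> z; rewrite lee_fin.
Qed.

(* Brunn-Minkowski on each superlevel set: below level 1 they are all nonempty
   since the suprema are at least 1. *)
Lemma prekopa_line_min (l : R) (f g h : MR -> R) : 0 < l < 1 ->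
  measurable_fun setT f -> measurable_fun setT g -> measurable_fun setT h ->
  (forall x, 0 <= f x <= 1) -> (forall x, 0 <= g x <= 1) -> (forall x, 0 <= h x) ->
  (forall t, t < 1 -> exists x, t < f x) -> (forall t, t < 1 -> exists x, t < g x) ->
  (forall x y, 0 < f x -> 0 < g y ->
    Num.min (f x) (g y) <= h ((1 - l) * x + l * y)) ->
  ((1 - l)%:E * \int[mu]_x (f x)%:E + l%:E * \int[mu]_x (g x)%:E <=
   \int[mu]_x (h x)%:E)%E.
Proof.
move=> l01 mf mg mh f01 g01 h0 f1 g1 fgh.
have /andP[l0 l1] := l01.
have f0 x : 0 <= f x by case/andP: (f01 x).
have g0 x : 0 <= g x by case/andP: (g01 x).
have minE (k : MR -> R) : (forall x, 0 <= k x <= 1) ->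
    (\int[mu]_x (k x)%:E = \int[mu]_x (Num.min (k x) 1)%:E)%E.
  move=> k01; apply: eq_integral => x _; congr EFin.
  by apply/esym/min_idPl; case/andP: (k01 x).
rewrite minE// [in X in (_ + X)%E]minE// -!integral_level//.
have lev0 (k : MR -> R) t : (0 <= level k t)%E by exact: measure_ge0.
have m0 : 0 <= 1 - l by rewrite subr_ge0 ltW.
rewrite -ge0_integralZl_EFin//; last exact: measurable_level.
rewrite -ge0_integralZl_EFin//; [|exact: measurable_level|exact: ltW].
rewrite -ge0_integralD//; first last.
- by apply: measurable_funeM; exact: measurable_level.
- by move=> t _; rewrite mule_ge0// lee_fin ltW.
- by apply: measurable_funeM; exact: measurable_level.
- by move=> t _; rewrite mule_ge0.
apply: (@le_trans _ _ (\int[mu]_t level h t)%E).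
  apply: ge0_le_integral => //.
  - by move=> t _; rewrite adde_ge0 ?mule_ge0// lee_fin ltW.
  - by apply: emeasurable_funD; apply: measurable_funeM; exact: measurable_level.
  - exact: measurable_level.
  move=> t _; have [t01|t01] := boolP (0 < t < 1); last first.
    rewrite /level (_ : [set x | _ /\ t < f x] = set0); last first.
      by apply/seteqP; split => x //= -[]; rewrite (negbTE t01).
    rewrite (_ : [set x | _ /\ t < g x] = set0); last first.
      by apply/seteqP; split => x //= -[]; rewrite (negbTE t01).
    by rewrite measure0 !mule0 adde0.
  have /andP[t0 t1] := t01.
  apply: brunn_minkowski_line => //; try exact: mset_level.
  - by have [x tx] := f1 _ t1; exists x.
  - by have [x tx] := g1 _ t1; exists x.
  - move=> x y [_ fx] [_ gy]; split => //.
    apply: lt_le_trans (fgh _ _ (lt_trans t0 fx) (lt_trans t0 gy)).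
    by rewrite lt_min fx.
rewrite integral_level//.
apply: ge0_le_integral => //.
- by move=> x _; rewrite lee_fin le_min h0 ler01.
- by apply/measurable_EFinP; apply: measurable_minr.
- exact/measurable_EFinP.
- by move=> x _; rewrite lee_fin ge_min lexx.
Qed.

Lemma borell_brascamp_lieb_line (l alpha M If Ig : R) (f g h : MR -> R) :
  0 < l < 1 -> 1 <= alpha ->
  measurable_fun setT f -> measurable_fun setT g -> measurable_fun setT h ->
  (forall x, 0 <= f x <= M) -> (forall x, 0 <= g x <= M) -> (forall x, 0 <= h x) ->
  0 < If -> 0 < Ig ->
  (\int[mu]_x (f x)%:E = If%:E)%E -> (\int[mu]_x (g x)%:E = Ig%:E)%E ->
  (forall x y, 0 < f x -> 0 < g y ->
    inv_mean l alpha (f x) (g y) <= h ((1 - l) * x + l * y)) ->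
  ((inv_mean l (alpha - 1) If Ig)%:E <= \int[mu]_x (h x)%:E)%E.
Proof.
move=> l01 al1 mf mg mh fM gM h0 If0 Ig0 IfE IgE fgh.
have /andP[l0 l1] := l01.
have al0 : 0 < alpha by exact: lt_le_trans al1.
have sup_pos (k : MR -> R) Ik : (forall x, 0 <= k x <= M) -> 0 < Ik ->
    (\int[mu]_x (k x)%:E = Ik%:E)%E -> [/\ 0 < sup (range k),
      forall x, k x <= sup (range k) &
      forall t, t < 1 -> exists x, t < (sup (range k))^-1 * k x].
  move=> kM Ik0 IkE.
  have hs : has_sup (range k).
    split; first by exists (k 0); exists 0.
    by exists M => _ [x _ <-]; case/andP: (kM x).
  have kS x : k x <= sup (range k).
    by apply: ub_le_sup; [case: hs|exists x].
  have S0 : 0 < sup (range k).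
    rewrite ltNge; apply/negP => S0; move: IkE.
    rewrite (eq_integral (cst 0%E)) ?integral0; last first.
      move=> x _; congr EFin; apply/eqP; rewrite eq_le (le_trans (kS x))//.
      by case/andP: (kM x).
    by move=> [] /eqP; rewrite lt_eqF.
  split => // t t1.
  have e0 : 0 < (1 - t) * sup (range k) by rewrite mulr_gt0// subr_gt0.
  have [_ [x _ <-] kx] := sup_adherent e0 hs.
  exists x; rewrite ltr_pdivlMl// mulrC; apply: le_lt_trans kx.
  by rewrite mulrBl mul1r subKr.
have [A0 fA f1] := sup_pos _ _ fM If0 IfE.
have [B0 gB g1] := sup_pos _ _ gM Ig0 IgE.
set A := sup (range f) in A0 fA f1; set B := sup (range g) in B0 gB g1.
(* The matching normalisation of [h]: if [m] is the minimum of [f x / A] and [g y / B], monotonicity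
   and homogeneity give [h >= inv_mean l alpha (m * A) (m * B) = m * N]. *)
pose N := inv_mean l alpha A B.
have N0 : 0 < N by exact: inv_mean_gt0.
have norm01 (k : MR -> R) S : 0 < S -> (forall x, 0 <= k x <= M) ->
    (forall x, k x <= S) -> forall x, 0 <= S^-1 * k x <= 1.
  move=> S0 kM kS x; have /andP[k0 _] := kM x.
  by rewrite mulr_ge0 ?invr_ge0 ?(ltW S0)//= ler_pdivrMl// mulr1.
have Zl (k : MR -> R) c : measurable_fun setT k -> (forall x, 0 <= k x) -> 0 <= c ->
    (\int[mu]_x (c * k x)%:E = c%:E * \int[mu]_x (k x)%:E)%E.
  move=> mk k0 c0; rewrite -ge0_integralZl_EFin//.
  - by move=> x _; rewrite lee_fin.
  - exact/measurable_EFinP.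
have f0 x : 0 <= f x by case/andP: (fM x).
have g0 x : 0 <= g x by case/andP: (gM x).
have := @prekopa_line_min l (fun x => A^-1 * f x) (fun x => B^-1 * g x)
  (fun x => N^-1 * h x) l01.
have mZ (k : MR -> R) c : measurable_fun setT k ->
    measurable_fun setT (fun x => c * k x).
  by move=> mk; exact: measurable_funM.
move=> /(_ (mZ _ _ mf) (mZ _ _ mg) (mZ _ _ mh)).
move=> /(_ (norm01 _ _ A0 fM fA) (norm01 _ _ B0 gM gB)).
rewrite !Zl ?invr_ge0 ?(ltW A0) ?(ltW B0) ?(ltW N0)// IfE IgE.
have hyp x y : 0 < A^-1 * f x -> 0 < B^-1 * g y ->
    Num.min (A^-1 * f x) (B^-1 * g y) <= N^-1 * h ((1 - l) * x + l * y).
  rewrite !pmulr_rgt0 ?invr_gt0// => fx gy.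
  rewrite ler_pdivlMl//; apply: le_trans (fgh _ _ fx gy).
  set m := Num.min _ _.
  have m0 : 0 < m by rewrite lt_min !mulr_gt0 ?invr_gt0.
  rewrite mulrC -(inv_meanZ l01 (ltW al0) m0 A0 B0).
  apply: ler_inv_mean => //; rewrite ?mulr_gt0 ?(ltW al0)//.
    by rewrite -ler_pdivlMr// mulrC ge_min lexx.
  by rewrite -ler_pdivlMr// mulrC ge_min lexx orbT.
have Nh0 x : 0 <= N^-1 * h x by rewrite mulr_ge0 ?invr_ge0 ?(ltW N0).
move=> /(_ Nh0 f1 g1 hyp).
rewrite -!EFinM -EFinD lee_pdivlMl// -EFinM; apply: le_trans.
rewrite lee_fin.
(* The integral of [h] is now at least [N] times the arithmetic mean of [If / A] and [Ig / B];
   Hölder's inequality restores [If] and [Ig]. *)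
have := @inv_meanM R l l01 alpha A B (A^-1 * If) (B^-1 * Ig) al1 A0 B0.
rewrite !mulVKf ?gt_eqF// !mulr_gt0 ?invr_gt0//; exact.
Qed.

End bbl_line.

(** * Iterated integrals and induction on the dimension *)

Section rV_integral.
Context {R : realType}.
Local Notation MR := (measurableTypeR R).

Definition box n (a b : 'rV[R]_n) : set 'rV[R]_n :=
  [set x | forall i, x ord0 i \in `[a ord0 i, b ord0 i]].

Lemma measurable_box n (a b : 'rV[R]_n) : measurable (box a b).
Proof.
rewrite (_ : box a b = \bigcap_(i in [set: 'I_n])
    ((fun x : 'rV[R]_n => x ord0 i : MR) @^-1`
      `[a ord0 i, b ord0 i]%classic)); last first.
  apply/seteqP; split => [x Bx i _|x Bx i]; first exact: Bx.
  exact: (Bx i).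
apply: fin_bigcap_measurable; first exact: finite_finset.
move=> i _; rewrite -[X in measurable X]setTI.
by apply: measurable_coord => //; exact: measurable_itv.
Qed.

Lemma rV_consEr n (s : R) (y : 'rV[R]_n) j :
  rV_cons (s, y) ord0 (lift ord0 j) = y ord0 j.
Proof.
rewrite /rV_cons (_ : lift ord0 j = rshift 1 j :> 'I_(1 + n)); last exact/val_inj.
by rewrite (@row_mxEr _ 1 1 n).
Qed.

Lemma rV_consEl n (s : R) (y : 'rV[R]_n) : rV_cons (s, y) ord0 ord0 = s.
Proof.
rewrite /rV_cons (_ : ord0 = lshift n ord0 :> 'I_(1 + n)); last exact/val_inj.
by rewrite (@row_mxEl _ 1 1 n) mxE eqxx mulr1n.
Qed.

Lemma rV_cons_convex n (a b s0 s1 : R) (y0 y1 : 'rV[R]_n) :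
  rV_cons (a * s0 + b * s1, a *: y0 + b *: y1) =
  a *: rV_cons (s0, y0) + b *: rV_cons (s1, y1).
Proof.
apply/rowP => i; have [j ->|->] := unliftP ord0 i.
  by rewrite rV_consEr [RHS]mxE [X in _ = X + _]mxE [X in _ = _ + X]mxE !rV_consEr !mxE.
apply: (etrans (rV_consEl _ _)).
rewrite [RHS]mxE [X in _ = X + _]mxE [X in _ = _ + X]mxE.
by congr (_ * _ + _ * _); apply/esym; exact: rV_consEl.
Qed.

Lemma measurable_section n (f : 'rV[R]_n.+1 -> R) (s : R) :
  measurable_fun setT f -> measurable_fun setT (fun y => f (rV_cons (s, y))).
Proof.
move=> mf; apply: (measurableT_comp mf).
apply: (measurableT_comp (@measurable_rV_cons R n)).
exact: measurable_fun_pair.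
Qed.

Lemma integral_rV_cons n (f : 'rV[R]_n.+1 -> R) :
  measurable_fun setT f -> (forall x, 0 <= f x) ->
  (\int[@lebesgue_rV R n.+1]_x (f x)%:E =
   \int[@lebesgue_measure R]_s \int[@lebesgue_rV R n]_y (f (rV_cons (s, y)))%:E)%E.
Proof.
move=> mf f0.
have mfc : measurable_fun setT (fun z => (f (rV_cons z))%:E).
  apply/measurable_EFinP; apply: (measurableT_comp mf).
  exact: measurable_rV_cons.
transitivity (\int[(@lebesgue_measure R \x @lebesgue_rV R n)%E]_z (f (rV_cons z))%:E)%E.
  rewrite (ge0_integral_pushforward (@measurable_rV_cons R n)
    (@lebesgue_measure R \x @lebesgue_rV R n)%E)//.
  - exact/measurable_EFinP.
  - by move=> y _; rewrite lee_fin.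
by rewrite fubini_tonelli1// => z; rewrite lee_fin.
Qed.

Lemma measurable_marginal n (f : 'rV[R]_n.+1 -> R) :
  measurable_fun setT f -> (forall x, 0 <= f x) ->
  measurable_fun setT (fun s : MR =>
    (\int[@lebesgue_rV R n]_y (f (rV_cons (s, y)))%:E)%E).
Proof.
move=> mf f0.
apply: (@measurable_fun_fubini_tonelli_F _ _ _ _ R (@lebesgue_rV R n)
  (fun z => (f (rV_cons z))%:E)).
  apply/measurable_EFinP; apply: (measurableT_comp mf).
  exact: measurable_rV_cons.
by move=> z; rewrite lee_fin.
Qed.

(** A class stable under fixing the first coordinate, whose marginals are bounded by
    [C * (2 * M) ^+ n]. They are thus real functions with finite suprema, as the one-dimensional
    inequality requires. *)
Definition bounded_in_cube n (M C : R) (f : 'rV[R]_n -> R) : Prop :=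
  [/\ measurable_fun setT f, forall x, 0 <= f x <= C &
      forall x, 0 < f x -> forall i, `|x ord0 i| <= M].

Lemma bounded_in_cube_ge0 n (M C : R) (f : 'rV[R]_n -> R) x :
  bounded_in_cube M C f -> 0 <= f x.
Proof. by move=> [_ fC _]; case/andP: (fC x). Qed.

Lemma integral_bounded_in_cube n (M C : R) (f : 'rV[R]_n -> R) :
  0 <= M -> bounded_in_cube M C f ->
  (\int[@lebesgue_rV R n]_y (f y)%:E <= (C * (2 * M) ^+ n)%:E)%E.
Proof.
move=> M0 [mf fC fM].
have C0 : 0 <= C by have /andP[/le_trans] := fC 0; exact.
pose B : set 'rV[R]_n := box (const_mx (- M)) (const_mx M).
have mB : measurable B by exact: measurable_box.
have muB : lebesgue_rV B = ((2 * M) ^+ n)%:E.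
  rewrite lebesgue_rV_box; last by move=> i; rewrite !mxE ge0_cp.
  congr EFin; under eq_bigr do rewrite !mxE.
  by rewrite prodr_const card_ord opprK mulr2n mulrDl mul1r.
apply: (@le_trans _ _ (\int[@lebesgue_rV R n]_y (C%:E * (\1_B y)%:E))%E).
  apply: ge0_le_integral => //.
  - by move=> x _; rewrite lee_fin; case/andP: (fC x).
  - exact/measurable_EFinP.
  - by apply: measurable_funeM; apply: measurableT_comp.
  move=> x _; rewrite -EFinM lee_fin indicE.
  have [xB|xB] := boolP (x \in B); first by rewrite mulr1; case/andP: (fC x).
  rewrite mulr0 leNgt; apply: contra xB => fx.
  rewrite inE => i; rewrite in_itv/= !mxE -ler_norml; exact: fM.
rewrite ge0_integralZl_EFin//.
  by rewrite EFinM -muB integral_indic ?setIT.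
by apply: measurableT_comp.
Qed.

Lemma fin_num_integral_in_cube n (M C : R) (f : 'rV[R]_n -> R) :
  0 <= M -> bounded_in_cube M C f ->
  (\int[@lebesgue_rV R n]_y (f y)%:E)%E \is a fin_num.
Proof.
move=> M0 fB; rewrite ge0_fin_numE.
  by apply: le_lt_trans (integral_bounded_in_cube M0 fB) _; rewrite ltry.
by apply: integral_ge0 => x _; rewrite lee_fin; exact: bounded_in_cube_ge0 fB.
Qed.

Lemma bounded_in_cube_section n (M C : R) (f : 'rV[R]_n.+1 -> R) s :
  bounded_in_cube M C f -> bounded_in_cube M C (fun y => f (rV_cons (s, y))).
Proof.
move=> [mf fC fM]; split => //; first exact: measurable_section.
by move=> y fy i; rewrite -(rV_consEr s); exact: fM.
Qed.

(** The induction hypothesis, applied to the sections at [s0] and [s1], is exactly the pointwise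
    hypothesis of the one-dimensional inequality for the marginals, with parameter [alpha - n]. The
    bound on [alpha] keeps this parameter at least 1 in that last integration. *)
Theorem borell_brascamp_lieb n (l alpha M C If Ig : R) (f g h : 'rV[R]_n -> R) :
  0 < l < 1 -> n%:R <= alpha -> 0 <= M ->
  bounded_in_cube M C f -> bounded_in_cube M C g -> bounded_in_cube M C h ->
  0 < If -> 0 < Ig ->
  (\int[@lebesgue_rV R n]_x (f x)%:E = If%:E)%E ->
  (\int[@lebesgue_rV R n]_x (g x)%:E = Ig%:E)%E ->
  (forall x y, 0 < f x -> 0 < g y ->
    inv_mean l alpha (f x) (g y) <= h ((1 - l) *: x + l *: y)) ->
  ((inv_mean l (alpha - n%:R) If Ig)%:E <= \int[@lebesgue_rV R n]_x (h x)%:E)%E.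
Proof.
move=> l01 + M0.
elim: n alpha If Ig f g h => [|n IH] alpha If Ig f g h al fB gB hB If0 Ig0.
  have d0 (k : 'rV[R]_0 -> R) : bounded_in_cube M C k ->
      (\int[@lebesgue_rV R 0]_x (k x)%:E = (k 0)%:E)%E.
    move=> [mk _ _]; rewrite /= integral_dirac//.
      by rewrite diracT mul1e.
    exact/measurable_EFinP.
  rewrite !d0// => -[fE] [gE] /(_ 0 0).
  by rewrite subr0 lee_fin !scaler0 addr0 fE gE; exact.
move=> fE gE fgh.
have al1 : 1 <= alpha - n%:R by rewrite lerBrDr addrC natr1.
have ge0 (k : 'rV[R]_n.+1 -> R) : bounded_in_cube M C k -> forall x, 0 <= k x.
  by move=> kB x; exact: bounded_in_cube_ge0 kB.
pose mar (k : 'rV[R]_n.+1 -> R) (s : R) :=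
  fine (\int[@lebesgue_rV R n]_y (k (rV_cons (s, y)))%:E).
have marE (k : 'rV[R]_n.+1 -> R) s : bounded_in_cube M C k ->
    (\int[@lebesgue_rV R n]_y (k (rV_cons (s, y)))%:E = (mar k s)%:E)%E.
  move=> kB; rewrite fineK//.
  exact: fin_num_integral_in_cube (bounded_in_cube_section s kB).
have intE (k : 'rV[R]_n.+1 -> R) : bounded_in_cube M C k ->
    (\int[@lebesgue_rV R n.+1]_x (k x)%:E =
     \int[@lebesgue_measure R]_s (mar k s)%:E)%E.
  move=> kB; have [mk _ _] := kB; rewrite integral_rV_cons//; last exact: ge0.
  by apply: eq_integral => s _; rewrite marE.
have mmar (k : 'rV[R]_n.+1 -> R) : bounded_in_cube M C k ->
    measurable_fun setT (mar k : MR -> R).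
  move=> kB; have [mk _ _] := kB.
  apply: (measurableT_comp (fine_measurable measurableT)).
  by apply: measurable_marginal => //; exact: ge0.
have mar0 (k : 'rV[R]_n.+1 -> R) s : bounded_in_cube M C k ->
    0 <= mar k s <= C * (2 * M) ^+ n.
  move=> kB; rewrite -!lee_fin -marE// integral_bounded_in_cube//.
    by rewrite andbT; apply: integral_ge0 => y _; rewrite lee_fin ge0.
  exact: bounded_in_cube_section.
rewrite intE// (_ : alpha - n.+1%:R = alpha - n%:R - 1); last first.
  by rewrite -natr1 opprD addrA.
apply: (@borell_brascamp_lieb_line R l (alpha - n%:R) (C * (2 * M) ^+ n) If Ig
  (mar f) (mar g) (mar h)) => //; try exact: mmar; try by move=> s; exact: mar0.
- by move=> s; case/andP: (mar0 h s hB).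
- by rewrite -intE.
- by rewrite -intE.
move=> s0 s1 f0 g0; rewrite -lee_fin -marE//.
apply: (IH _ _ _ (fun y => f (rV_cons (s0, y))) (fun y => g (rV_cons (s1, y)))) => //.
- by rewrite (le_trans _ al)// ler_nat.
- exact: bounded_in_cube_section.
- exact: bounded_in_cube_section.
- exact: bounded_in_cube_section.
- exact: marE.
- exact: marE.
by move=> y0 y1 fy gy; rewrite rV_cons_convex; exact: fgh.
Qed.

End rV_integral.

(** * Functions concave on their support *)

Section cubes.
Context {R : realType} {n : nat}.
Implicit Types (x y z p b : 'rV[R]_n) (A : set 'rV[R]_n).

Definition cube x (r : R) : set 'rV[R]_n :=
  [set y | forall i, `|y ord0 i - x ord0 i| <= r].

Lemma cubeE x r : cube x r = box (x - const_mx r) (x + const_mx r).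
Proof.
apply/seteqP; split => y Hy i.
  by rewrite in_itv/= !mxE -ler_distl; exact: Hy.
by have := Hy i; rewrite in_itv/= !mxE -ler_distl.
Qed.

Lemma measurable_cube x r : measurable (cube x r).
Proof. by rewrite cubeE; exact: measurable_box. Qed.

Lemma lebesgue_rV_cube x r : 0 <= r ->
  lebesgue_rV (cube x r) = ((2 * r) ^+ n)%:E.
Proof.
move=> r0; rewrite cubeE lebesgue_rV_box; last first.
  by move=> i; rewrite !mxE lerD2l ge0_cp.
congr EFin; under eq_bigr do rewrite !mxE.
rewrite (eq_bigr (fun=> 2 * r)); first by rewrite prodr_const card_ord.
by move=> i _; ring.
Qed.

Lemma cube_center x r : 0 <= r -> cube x r x.
Proof. by move=> r0 i; rewrite subrr normr0. Qed.

Lemma subset_cube x y r s t : r + s <= t -> cube x r y -> cube y s `<=` cube x t.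
Proof.
move=> rst xy z yz i; rewrite (le_trans _ rst)// [leRHS]addrC.
have -> : z ord0 i - x ord0 i = (z ord0 i - y ord0 i) + (y ord0 i - x ord0 i).
  by ring.
by rewrite (le_trans (ler_normD _ _))// lerD.
Qed.

(* The sigma-algebra on ['rV[R]_n] is generated by the coordinates; cubes with
   rational centres form a countable base. *)
Lemma measurable_cube_open A :
  (forall x, A x -> exists2 r, 0 < r & cube x r `<=` A) -> measurable A.
Proof.
move=> Aop.
pose Q (u : 'rV[rat]_n * nat) : set 'rV[R]_n :=
  cube (map_mx ratr u.1) u.2.+1%:R^-1.
have -> : A = \bigcup_u (if `[< Q u `<=` A >] then Q u else set0).
  apply/seteqP; split => [x Ax|x [u _]]; last first.
    by case: ifPn => // /asboolP QA; exact: QA.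
  have [r r0 xrA] := Aop _ Ax.
  pose k := Num.truncn (2 / r); pose e : R := k.+1%:R^-1.
  have e0 : 0 < e by rewrite invr_gt0.
  have er : e + e <= r.
    have : 2 / r <= k.+1%:R by exact/ltW/truncnS_gt.
    rewrite ler_pdivrMr// => kr.
    by rewrite -[e + e]mulr2n -mulr_natr /e ler_pdivrMl.
  have /choice[c cP] : forall i : 'I_n, exists q : rat,
      `|x ord0 i - ratr q| <= e.
    move=> i; have xe : x ord0 i - e < x ord0 i + e by rewrite ltrD2l gtrN.
    have [q] := rat_in_itvoo xe; rewrite in_itv/= -ltr_distl distrC => /ltW.
    by exists q.
  have Qx : Q (\row_i c i, k) x by move=> i; rewrite !mxE; exact: cP.
  exists (\row_i c i, k) => //; case: asboolP => //; case.
  apply: subset_trans xrA; apply: subset_cube er _ => i.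
  by rewrite distrC; exact: Qx.
apply: countable_bigcupT_measurable => [|u]; first exact: countableP.
by case: ifPn => // _; exact: measurable_cube.
Qed.

End cubes.

Section concave_on_support.
Context {R : realType} {n : nat}.
Implicit Types (x y z p b : 'rV[R]_n).
Variable g : 'rV[R]_n -> R.
Hypothesis g0 : forall x, 0 <= g x.
Hypothesis gc : forall x y l, 0 <= l <= 1 -> 0 < g x -> 0 < g y ->
  (1 - l) * g x + l * g y <= g ((1 - l) *: x + l *: y).

Let B : set 'rV[R]_n := [set x | 0 < g x].

Definition support_interior : set 'rV[R]_n :=
  [set x | exists2 r, 0 < r & cube x r `<=` [set y | 0 < g y]].
Local Notation U := support_interior.

Lemma sub_support_interior : U `<=` B.
Proof. by move=> x [r r0]; apply; exact/cube_center/ltW. Qed.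

Lemma support_interior_open x : U x -> exists2 r, 0 < r & cube x r `<=` U.
Proof.
move=> [r r0 xr]; exists (r / 2); first by rewrite divr_gt0.
move=> y xy; exists (r / 2); first by rewrite divr_gt0.
by apply: subset_trans xr; apply: subset_cube xy; rewrite -splitr.
Qed.

Lemma measurable_support_interior : measurable U.
Proof. by apply: measurable_cube_open; exact: support_interior_open. Qed.

(** The cube is the image of [cube p r] under the homothety of centre [b] and ratio [1 - l]; below,
    [z] is the preimage of [y]. *)
Lemma cube_conv (l r : R) p b : 0 <= l < 1 -> cube p r `<=` B -> B b ->
  cube ((1 - l) *: p + l *: b) ((1 - l) * r) `<=` B.
Proof.
move=> /andP[l0 l1] pB Bb y Hy.
have m0 : 0 < 1 - l by rewrite subr_gt0.
pose z := p + (1 - l)^-1 *: (y - ((1 - l) *: p + l *: b)).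
have Bz : B z.
  apply: pB => i; rewrite /z !mxE addrAC subrr add0r normrM.
  rewrite (gtr0_norm (_ : 0 < (1 - l)^-1)) ?invr_gt0// ler_pdivrMl//.
  by have := Hy i; rewrite !mxE.
have -> : y = (1 - l) *: z + l *: b.
  rewrite /z scalerDr scalerA mulfV ?gt_eqF// scale1r.
  by rewrite -[RHS]addrA addrCA subrK.
rewrite /B/=; apply: lt_le_trans (gc _ Bz Bb); last by rewrite l0 ltW.
by rewrite ltr_wpDr ?mulr_ge0// mulr_gt0.
Qed.

Lemma support_interior_conv (l : R) p b : 0 <= l < 1 -> U p -> B b ->
  U ((1 - l) *: p + l *: b).
Proof.
move=> /andP[l0 l1] [r r0 pr] Bb; exists ((1 - l) * r).
  by rewrite mulr_gt0// subr_gt0.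
by apply: cube_conv => //; rewrite l0.
Qed.

(* Along segments from an interior point [x] to the boundary of a cube in the
   support, [g] loses at most the factor [1 - l]; so [g] is lower
   semicontinuous on the interior. *)
Lemma concave_support_lower x r l y : 0 < l <= 1 -> cube x r `<=` B ->
  cube x (l * r) y -> (1 - l) * g x <= g y.
Proof.
move=> /andP[l0 l1] xr xy.
pose b := x + l^-1 *: (y - x).
have Bb : B b.
  apply: xr => i; rewrite /b !mxE addrAC subrr add0r normrM.
  by rewrite gtr0_norm ?invr_gt0// ler_pdivrMl//; exact: xy.
have [->|gx] := eqVneq (g x) 0; first by rewrite mulr0.
have Bx : 0 < g x by rewrite lt_neqAle eq_sym gx g0.
have -> : y = (1 - l) *: x + l *: b.
  rewrite /b scalerDr scalerA mulfV ?gt_eqF// scale1r addrA -scalerDl.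
  by rewrite subrK scale1r addrC subrK.
apply: le_trans (gc _ Bx Bb); last by rewrite (ltW l0).
by rewrite lerDl mulr_ge0// ltW.
Qed.

(* Unlike [g], this is always Borel. *)
Definition support_trim x : R := if `[< U x >] then g x else 0.

Lemma support_trim_in x : U x -> support_trim x = g x.
Proof. by rewrite /support_trim; case: asboolP. Qed.

Lemma support_trim_gt0 x : 0 < support_trim x <-> U x.
Proof.
rewrite /support_trim; case: asboolP => Ux; last by rewrite ltxx.
by split => // _; exact: sub_support_interior.
Qed.

Lemma support_trim_ge0 x : 0 <= support_trim x.
Proof. by rewrite /support_trim; case: ifP. Qed.

Lemma support_trim_le x : support_trim x <= g x.
Proof. by rewrite /support_trim; case: ifP. Qed.

Lemma measurable_support_trim : measurable_fun setT support_trim.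
Proof.
apply: (measurability _ (RGenOInfty.measurableE R)).
move=> _ [_ [a ->] <-]; rewrite setTI.
have [a0|a0] := ltP a 0.
  rewrite (_ : _ @^-1` _ = setT)//; apply/seteqP; split => // x _ /=.
  by rewrite in_itv/= andbT (lt_le_trans a0)// support_trim_ge0.
apply: measurable_cube_open => x /=; rewrite in_itv/= andbT => ax.
have Ux : U x by apply/support_trim_gt0; exact: le_lt_trans ax.
have gx : a < g x by rewrite -support_trim_in.
have gx0 : 0 < g x by exact: le_lt_trans gx.
have [r r0 xr] := support_interior_open Ux.
(* Half of the admissible relative loss, so that [(1 - l) * g x] still exceeds [a]. *)
pose l := (1 - a / g x) / 2.
have ag : a / g x < 1 by rewrite ltr_pdivrMr// mul1r.
have ag0 : 0 <= a / g x by rewrite divr_ge0.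
have l0 : 0 < l by rewrite divr_gt0// subr_gt0.
have l1 : l <= 1 by rewrite ler_pdivrMr//; lra.
exists (l * r); first by rewrite mulr_gt0.
move=> y xy /=; rewrite in_itv/= andbT.
have Uy : U y.
  apply: xr => i; apply: (le_trans (xy i)).
  by rewrite ler_piMl// ltW.
rewrite support_trim_in//.
apply: lt_le_trans (concave_support_lower (r := r) _ _ xy).
- rewrite -ltr_pdivrMr//; rewrite /l; lra.
- by rewrite l0.
- exact: subset_trans sub_support_interior.
Qed.

Hypothesis U0 : U !=set0.
Variable M : R.
Hypothesis BM : forall x, B x -> forall i, `|x ord0 i| <= M.

(* A point of the support is reflected through an interior point. *)
Lemma concave_support_bounded : exists C, forall x, g x <= C.
Proof.
have [p [r r0 pr]] := U0.
have Bp : B p by apply: pr; exact/cube_center/ltW.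
(* [N] exceeds all coordinate distances within the support, so the reflected point [y] stays in the
   cube around [p]. The weight [l] solves [p = (1 - l) *: y + l *: x], whence [l * g x <= g p]. *)
pose N := 2 * `|M| + 1.
have N0 : 0 < N by rewrite ltr_wpDl// mulr_ge0.
pose l := r / (r + N).
have rN : 0 < r + N by rewrite addr_gt0.
have l0 : 0 < l by rewrite divr_gt0.
have l1 : l < 1 by rewrite ltr_pdivrMr// mul1r ltrDl.
exists (g p / l) => x; rewrite ler_pdivlMr// mulrC.
have [gx|gx] := leP (g x) 0.
  by rewrite (le_trans (mulr_ge0_le0 (ltW l0) gx))// g0.
pose y := p - (r / N) *: (x - p).
have By : B y.
  apply: pr => i; rewrite /y !mxE addrAC subrr add0r normrN normrM.
  rewrite gtr0_norm ?divr_gt0// mulrAC ler_pdivrMr// ler_pM2l//.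
  rewrite (le_trans (ler_normB _ _))// /N.
  have := BM gx i; have := BM Bp i; have := ler_norm M.
  by move: `|x _ _| `|p _ _| `|M| => a b c; lra.
have -> : p = (1 - l) *: y + l *: x.
  apply/rowP => i; rewrite /y !mxE /l; field.
  by rewrite !gt_eqF.
apply: le_trans (gc _ By gx); last by rewrite (ltW l0) ltW.
by rewrite lerDr mulr_ge0// subr_ge0 ltW.
Qed.

End concave_on_support.

Lemma bernoulli_ineq (R : realType) (n : nat) (d : R) :
  0 <= d <= 1 -> 1 - n%:R * d <= (1 - d) ^+ n.
Proof.
move=> /andP[d0 d1]; elim: n => [|n IH]; first by rewrite mul0r subr0.
have m0 : 0 <= 1 - d by rewrite subr_ge0.
rewrite exprS; apply: le_trans (ler_wpM2l m0 IH).
have : 0 <= n%:R * d * d by rewrite !mulr_ge0.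
rewrite -natr1; lra.
Qed.

(** For positive [n], dropping the term in [c] only increases the negative power. The bound is
    uniform in [c], so an indicator may be multiplied by an arbitrarily large constant. *)
Lemma inv_mean_le_pow (R : realType) (n : nat) (l c : R) : 0 < l < 1 -> 0 < c ->
  inv_mean l n%:R c 1 <= l ^- n.
Proof.
move=> l01 c0; have /andP[l0 l1] := l01.
case: n => [|n]; first by rewrite /inv_mean eqxx expr0 invr1 ge_min lexx orbT.
rewrite /inv_mean pnatr_eq0/= powR1 mulr1 -(powR_invn _ (ltW l0)).
apply: ler_powR_npos => //.
by rewrite lerDr mulr_ge0 ?powR_ge0// subr_ge0 ltW.
Qed.

(** * Negligibility of the support outside its interior *)

Section null_boundary.
Context {R : realType} {n : nat}.
Implicit Types (x y z p b : 'rV[R]_n).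
Variable g : 'rV[R]_n -> R.
Hypothesis g0 : forall x, 0 <= g x.
Hypothesis gc : forall x y l, 0 <= l <= 1 -> 0 < g x -> 0 < g y ->
  (1 - l) * g x + l * g y <= g ((1 - l) *: x + l *: y).
Local Notation U := (support_interior g).
Hypothesis U0 : U !=set0.
Variable M : R.
Hypothesis M0 : 0 <= M.
Hypothesis BM : forall x, 0 < g x -> forall i, `|x ord0 i| <= M.

Let mU : measurable U.
Proof. exact: measurable_support_interior. Qed.

Lemma bounded_in_cube_indic (C c : R) (E : set 'rV[R]_n) :
  measurable E -> E `<=` [set x | 0 < g x] -> 0 <= c <= C ->
  bounded_in_cube M C (fun x => c * \1_E x).
Proof.
move=> mE EB /andP[c0 cC]; split.
- by apply: measurable_funM.
- move=> x; rewrite indicE; case: (x \in E); rewrite ?mulr1 ?mulr0 ?c0//=.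
  by rewrite lexx (le_trans c0).
- move=> x; rewrite indicE; have [xE _|_] := boolP (x \in E).
    by apply: BM; apply: EB; rewrite -inE.
  by rewrite mulr0 ltxx.
Qed.

Lemma integral_scaled_indic (c : R) (E : set 'rV[R]_n) : measurable E -> 0 <= c ->
  (\int[@lebesgue_rV R n]_x (c * \1_E x)%:E = c%:E * @lebesgue_rV R n E)%E.
Proof.
move=> mE c0; under eq_integral do rewrite EFinM.
rewrite ge0_integralZl_EFin//; first by rewrite integral_indic ?setIT.
by apply: measurableT_comp.
Qed.

(* Borell-Brascamp-Lieb with a huge multiple of the indicator of an interior
   cube [D] plays the role of the homothety of ratio [l] centred in [D], which
   maps the support into its interior. *)
Lemma support_boundary_null (A : set 'rV[R]_n) : measurable A ->
  A `<=` [set x | 0 < g x] -> A `&` U = set0 -> (@lebesgue_rV R n A = 0)%E.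
Proof.
move=> mA AB AU.
have [p Up] := U0; have [r r0 rU] := support_interior_open Up.
pose D := cube p r; have mD : measurable D by exact: measurable_cube.
have UB := @sub_support_interior _ _ g.
have fin (E : set 'rV[R]_n) : measurable E -> E `<=` [set x | 0 < g x] ->
    @lebesgue_rV R n E \is a fin_num.
  move=> mE EB; rewrite -[@lebesgue_rV R n E]mul1e -(integral_scaled_indic mE ler01).
  apply: (@fin_num_integral_in_cube R n M 1) => //.
  by apply: bounded_in_cube_indic => //; rewrite ler01 lexx.
pose mu (E : set 'rV[R]_n) := fine (@lebesgue_rV R n E).
have muE E : measurable E -> E `<=` [set x | 0 < g x] ->
    @lebesgue_rV R n E = (mu E)%:E.
  by move=> mE EB; rewrite fineK//; exact: fin.
have muA0 : 0 <= mu A by apply: fine_ge0; exact: measure_ge0.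
have DE : @lebesgue_rV R n D = ((2 * r) ^+ n)%:E by rewrite lebesgue_rV_cube// ltW.
have d0 : 0 < (2 * r) ^+ n by rewrite exprn_gt0// mulr_gt0.
have EB : U `|` A `<=` [set x | 0 < g x] by move=> x [/UB|/AB].
have mE : measurable (U `|` A) by exact: measurableU.
have EE : @lebesgue_rV R n (U `|` A) = (mu U + mu A)%:E.
  by rewrite EFinD -!muE// -measureU// setIC.
have S0 : 0 < mu U + mu A.
  rewrite -lte_fin -EE; apply: (@lt_le_trans _ _ (@lebesgue_rV R n D)).
    by rewrite DE lte_fin.
  by apply: le_measure; rewrite ?inE// => x /rU; left.
have key l : 0 < l < 1 -> l ^+ n * (mu U + mu A) <= mu U.
  move=> l01; have /andP[l0 l1] := l01.
  (* This [c] gives both functions the same integral. With [alpha = n] the resulting mean is a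
     minimum, hence this common value. *)
  pose c := (mu U + mu A) / (2 * r) ^+ n.
  have c0 : 0 < c by rewrite divr_gt0.
  pose C := Num.max (Num.max c 1) (l ^- n).
  have cC : c <= C by rewrite !le_max lexx.
  have oneC : 1 <= C by rewrite !le_max lexx orbT.
  have lC : l ^- n <= C by rewrite !le_max lexx orbT.
  have ln0 : 0 < l ^- n by rewrite invr_gt0 exprn_gt0.
  have := @borell_brascamp_lieb R n l n%:R M C (mu U + mu A) (mu U + mu A)
    (fun x => c * \1_D x) (fun x => 1 * \1_(U `|` A) x)
    (fun x => l ^- n * \1_U x) l01 (lexx _) M0.
  rewrite subrr {2}/inv_mean eqxx minxx !integral_scaled_indic ?(ltW c0) ?(ltW ln0)//.
  rewrite EE DE mul1e -EFinM mulfVK ?gt_eqF//.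
  rewrite (muE U)//.
  rewrite mulrC -ler_pdivlMr ?exprn_gt0// mulrC -lee_fin EFinM; apply => //.
  - apply: bounded_in_cube_indic => //; last by rewrite (ltW c0).
    by apply: subset_trans UB.
  - by apply: bounded_in_cube_indic => //; rewrite ler01.
  - by apply: bounded_in_cube_indic => //; rewrite (ltW ln0).
  move=> x y; rewrite !indicE pmulr_rgt0// mul1r.
  have [xD _|] := boolP (x \in D); last by rewrite ltxx.
  have [yE _|] := boolP (y \in _); last by rewrite ltxx.
  rewrite mulr1 mem_set; last first.
    apply: support_interior_conv => //; first by rewrite (ltW l0).
      by apply: rU; rewrite -inE.
    by apply: EB; rewrite -inE.
  by rewrite mulr1; exact: inv_mean_le_pow.
rewrite muE//; congr EFin; apply/eqP; rewrite eq_le muA0 andbT leNgt; apply/negP => A0.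
pose S := mu U + mu A.
(* Small enough that [n * d * S <= mu A / 2]. Bernoulli's inequality and [key] at ratio [1 - d] then
   give [S - mu A / 2 <= mu U], which is absurd for positive [mu A]. *)
pose d := mu A / (2 * n.+1%:R * S).
have n10 : 0 < n.+1%:R :> R by [].
have dd0 : 0 < 2 * n.+1%:R * S by rewrite !mulr_gt0.
have muU0 : 0 <= mu U by apply: fine_ge0; exact: measure_ge0.
have dp : 0 < d by rewrite divr_gt0.
have dE : 2 * n.+1%:R * S * d = mu A by rewrite /d mulrC divfK ?gt_eqF.
have d1 : d < 1.
  rewrite ltr_pdivrMr// mul1r; apply: (@lt_le_trans _ _ (2 * S)).
    by rewrite /S; lra.
  by rewrite ler_pM2r// ler_peMr// ler1n.
have := key (1 - d); rewrite subr_gt0 d1 gtrBl dp => /(_ isT).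
move=> keyd; have := @bernoulli_ineq R n d; rewrite (ltW dp) (ltW d1) => /(_ isT).
rewrite -(ler_pM2r S0) -/S => /le_trans /(_ keyd).
have nS : n%:R * d * S <= mu A / 2.
  rewrite ler_pdivlMr// -dE -natr1.
  have : 0 <= d * S by rewrite mulr_ge0 ?ltW.
  lra.
rewrite mulrBl mul1r {1}/S; lra.
Qed.

Import HBNNSimple.

(** The left integrand may be non-measurable, so its integral is handled as a supremum over simple
    functions. For such a [phi], the set where [phi] is positive off the interior is Borel and
    contained in the support, hence null. *)
Lemma integral_support_trim (k : 'rV[R]_n -> R) :
  measurable_fun setT k -> (forall x, 0 < k x) ->
  (\int[@lebesgue_rV R n]_x (k x * g x)%:E =
   \int[@lebesgue_rV R n]_x (k x * support_trim g x)%:E)%E.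
Proof.
move=> mk k0.
have kg0 x : 0 <= k x * g x by rewrite mulr_ge0// ltW.
have kt0 x : 0 <= k x * support_trim g x.
  by rewrite mulr_ge0 ?(ltW (k0 _))// support_trim_ge0.
have mt : measurable_fun setT (fun x => k x * support_trim g x).
  by apply: measurable_funM => //; exact: measurable_support_trim.
apply/eqP; rewrite eq_le; apply/andP; split; last first.
  rewrite ge0_integralTE ?[leRHS]ge0_integralTE//; last first.
  apply: le_ereal_sup => _ [phi phile <-]; exists phi => //= x.
  apply: (le_trans (phile x)); rewrite lee_fin ler_pM2l//.
  exact: support_trim_le.
rewrite ge0_integralTE//; apply: ge_ereal_sup => _ [phi /= phile <-].
rewrite -integralT_nnsfun.
apply: ae_ge0_le_integral => //.
- by move=> x _; rewrite lee_fin; exact: fun_ge0.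
- by apply/measurable_EFinP.
- by move=> x _; rewrite lee_fin.
- exact/measurable_EFinP.
pose A := [set x | 0 < phi x] `\` U.
have mA : measurable A.
  apply: measurableD; last exact: measurable_support_interior.
  exact: (@measurable_set_ltr _ _ R (cst 0)).
exists A; split => //.
  apply: support_boundary_null => //.
    move=> x [/= phi0 _]; have := phile x; rewrite lee_fin => /(lt_le_trans phi0).
    by rewrite pmulr_rgt0.
  by apply/seteqP; split => x // [[]].
move=> x /= /not_implyP[_ H]; split => /=.
  rewrite lt_neqAle eq_sym; apply/andP; split => //.
  by apply/eqP => e; apply: H; rewrite e lee_fin.
move=> Ux; apply: H; rewrite lee_fin support_trim_in// -lee_fin.
exact: phile.
Qed.

End null_boundary.

(** * The Poisson kernel *)

Section poisson_kernel.
Context {R : realType}.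

Definition sqnorm n (u : 'rV[R]_n) : R := \sum_(i < n) u ord0 i ^+ 2.
Definition dotr n (u w : 'rV[R]_n) : R := \sum_(i < n) u ord0 i * w ord0 i.

Lemma sqnorm_ge0 n (u : 'rV[R]_n) : 0 <= sqnorm u.
Proof. by apply: sumr_ge0 => i _; rewrite sqr_ge0. Qed.

Lemma sqr_coord_le n (u : 'rV[R]_n) i : u ord0 i ^+ 2 <= sqnorm u.
Proof.
rewrite /sqnorm (bigD1 i)//= lerDl.
by apply: sumr_ge0 => j _; rewrite sqr_ge0.
Qed.

Lemma enorm_sqr n (u : 'rV[R]_n) : enorm u ^+ 2 = sqnorm u.
Proof. by rewrite sqr_sqrtr// sqnorm_ge0. Qed.

Lemma sqnorm_comb n (a b : R) (u w : 'rV[R]_n) :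
  sqnorm (a *: u + b *: w) =
  a ^+ 2 * sqnorm u + 2 * a * b * dotr u w + b ^+ 2 * sqnorm w.
Proof.
rewrite /sqnorm /dotr !mulr_sumr -!big_split/=.
by apply: eq_bigr => i _; rewrite !mxE; ring.
Qed.

Lemma sqnormZ n (a : R) (u : 'rV[R]_n) : sqnorm (a *: u) = a ^+ 2 * sqnorm u.
Proof. by rewrite -[a *: u]addr0 -(scale0r 0) sqnorm_comb; ring. Qed.

Lemma dotr_sqr_le n (u w : 'rV[R]_n) : dotr u w ^+ 2 <= sqnorm u * sqnorm w.
Proof.
have [w0|w0] := eqVneq (sqnorm w) 0.
  rewrite w0 mulr0 /dotr big1 ?expr0n// => i _.
  have := sqr_coord_le w i; rewrite w0 => wi.
  have /eqP -> : w ord0 i == 0 by rewrite -sqrf_eq0 eq_le wi sqr_ge0.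
  by rewrite mulr0.
have wp : 0 < sqnorm w by rewrite lt_neqAle eq_sym w0 sqnorm_ge0.
have := sqnorm_ge0 (sqnorm w *: u + (- dotr u w) *: w).
rewrite sqnorm_comb; set a := sqnorm u; set b := dotr u w; set c := sqnorm w.
rewrite (_ : _ + _ = c * (a * c - b ^+ 2)); last by ring.
by rewrite pmulr_rge0// subr_ge0.
Qed.

(** The Euclidean norm of [(u, t)] in one more dimension. *)
Definition cone_norm (t : R) n (u : 'rV[R]_n) : R := Num.sqrt (sqnorm u + t ^+ 2).

Lemma cone_norm_sqr t n (u : 'rV[R]_n) : cone_norm t u ^+ 2 = sqnorm u + t ^+ 2.
Proof. by rewrite sqr_sqrtr// addr_ge0 ?sqnorm_ge0 ?sqr_ge0. Qed.

Lemma cone_norm_gt0 t n (u : 'rV[R]_n) : 0 < t -> 0 < cone_norm t u.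
Proof. by move=> t0; rewrite sqrtr_gt0 ltr_wpDl ?sqnorm_ge0// exprn_gt0. Qed.

(** With [a], [b] the two norms and [J = dotr u w + t ^ 2], the squares differ by
    [2 * l * (1 - l) * (a * b - J)]. Cauchy-Schwarz gives [(a * b) ^ 2 - J ^ 2 >= t ^ 2 * d], and
    the factor [a * b + J] is at most [2 * K ^ 2]. *)
Lemma cone_norm_conv_gap (t l K d : R) n (u w : 'rV[R]_n) :
  0 < t -> 0 < l < 1 -> cone_norm t u <= K -> cone_norm t w <= K ->
  0 <= d -> d <= sqnorm (w - u) ->
  cone_norm t ((1 - l) *: u + l *: w) ^+ 2 + l * (1 - l) * (t ^+ 2 * d / K ^+ 2) <=
  ((1 - l) * cone_norm t u + l * cone_norm t w) ^+ 2.
Proof.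
move=> t0 /andP[l0 l1] uK wK d0 duw.
have ml0 : 0 < 1 - l by rewrite subr_gt0.
have a0 := cone_norm_gt0 u t0; have b0 := cone_norm_gt0 w t0.
have aE := cone_norm_sqr t u; have bE := cone_norm_sqr t w.
rewrite cone_norm_sqr sqnorm_comb.
have := dotr_sqr_le u w; move: duw.
rewrite (_ : w - u = 1 *: w + (-1) *: u); last by rewrite scale1r scaleN1r.
rewrite sqnorm_comb (_ : dotr w u = dotr u w); last first.
  by apply: eq_bigr => i _; rewrite mulrC.
have A0 := sqnorm_ge0 u; have B0 := sqnorm_ge0 w.
move: (cone_norm t u) (cone_norm t w) (sqnorm u) (sqnorm w) (dotr u w)
  uK wK a0 b0 aE bE A0 B0 => a b A B I aK bK a0 b0 aE bE A0 B0 dI CS.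
have K0 : 0 < K by exact: lt_le_trans aK.
pose J := I + t ^+ 2.
have ab0 : 0 < a * b by rewrite mulr_gt0.
have abK : a * b <= K ^+ 2 by rewrite expr2 ler_pM// ltW.
have gap : t ^+ 2 * d <= (a * b) ^+ 2 - J ^+ 2.
  rewrite exprMn aE bE /J.
  have : t ^+ 2 * d <= t ^+ 2 * (A + B - 2 * I).
    by rewrite ler_pM2l ?exprn_gt0//; move: dI; lra.
  move: CS; nra.
have Jab : J <= a * b.
  rewrite leNgt; apply/negP => abJ.
  have : (a * b) ^+ 2 < J ^+ 2.
    by rewrite ltr_pXn2r// nnegrE ltW// (lt_trans ab0).
  have : 0 <= t ^+ 2 * d by rewrite mulr_ge0// sqr_ge0.
  lra.
have main : t ^+ 2 * d / K ^+ 2 <= 2 * (a * b - J).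
  rewrite ler_pdivrMr ?exprn_gt0//; apply: le_trans gap _.
  rewrite subr_sqr -mulrA [leRHS]mulrCA ler_wpM2l ?subr_ge0//.
  lra.
have ll0 : 0 < l * (1 - l) by rewrite mulr_gt0.
move: main; rewrite -(ler_pM2l ll0) /J => main.
have -> : A = a ^+ 2 - t ^+ 2 by rewrite aE addrK.
have -> : B = b ^+ 2 - t ^+ 2 by rewrite bE addrK.
apply: le_trans (lerD (lexx _) main) _.
by rewrite le_eqVlt; apply/orP; left; apply/eqP; ring.
Qed.

Lemma cone_norm_conv (t l : R) n (u w : 'rV[R]_n) : 0 < t -> 0 < l < 1 ->
  cone_norm t ((1 - l) *: u + l *: w) <= (1 - l) * cone_norm t u + l * cone_norm t w.
Proof.
move=> t0 l01; have /andP[l0 l1] := l01.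
have s0 : 0 <= (1 - l) * cone_norm t u + l * cone_norm t w.
  by rewrite ltW// wsum_gt0// cone_norm_gt0.
pose K := Num.max (cone_norm t u) (cone_norm t w).
have := @cone_norm_conv_gap t l K 0 n u w t0 l01.
rewrite /K !le_max !lexx orbT mulr0 mul0r mulr0 addr0 => /(_ isT isT isT).
move=> /(_ (sqnorm_ge0 _)).
by rewrite ler_pXn2r// nnegrE// ltW// cone_norm_gt0.
Qed.

(** A gain [e] in the squares becomes a factor [1 + e / K ^ 2], the norm of the combination being at
    most [K]. A factor is what passes through the power defining the kernel. *)
Lemma cone_norm_conv_ratio (t l K d : R) n : 0 < t -> 0 < l < 1 -> 0 < K -> 0 < d ->
  exists2 rho, 1 < rho & forall u w : 'rV[R]_n,
    cone_norm t u <= K -> cone_norm t w <= K -> d <= sqnorm (w - u) ->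
    rho * cone_norm t ((1 - l) *: u + l *: w) <=
    (1 - l) * cone_norm t u + l * cone_norm t w.
Proof.
move=> t0 l01 K0 d0; have /andP[l0 l1] := l01.
have ml0 : 0 < 1 - l by rewrite subr_gt0.
pose e := l * (1 - l) * (t ^+ 2 * d / K ^+ 2).
have e0 : 0 < e by rewrite !mulr_gt0 ?invr_gt0 ?exprn_gt0.
have eK : 0 < e / K ^+ 2 by rewrite divr_gt0 ?exprn_gt0.
exists (Num.sqrt (1 + e / K ^+ 2)).
  by rewrite -[ltLHS]sqrtr1 ltr_sqrt ?ltrDl// addr_gt0.
move=> u w uK wK duw; set c := cone_norm t (_ + _).
have c0 : 0 < c by exact: cone_norm_gt0.
have sK : (1 - l) * cone_norm t u + l * cone_norm t w <= K.
  rewrite (le_trans (lerD (ler_wpM2l (ltW ml0) uK) (ler_wpM2l (ltW l0) wK)))//.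
  by rewrite -mulrDl subrK mul1r.
have cK : c <= K by exact: le_trans (cone_norm_conv u w t0 l01) sK.
have s0 : 0 < (1 - l) * cone_norm t u + l * cone_norm t w.
  by rewrite wsum_gt0// cone_norm_gt0.
rewrite -(@ler_pXn2r _ 2)// ?nnegrE ?mulr_ge0 ?sqrtr_ge0 ?(ltW c0) ?(ltW s0)//.
rewrite exprMn sqr_sqrtr; last by rewrite addr_ge0// ltW.
apply: le_trans (cone_norm_conv_gap t0 l01 uK wK (ltW d0) duw).
rewrite -/c -/e mulrDl mul1r lerD2l -mulrA mulrC ger_pMl// mulrC.
by rewrite ler_pdivrMr ?exprn_gt0// mul1r ler_pXn2r// nnegrE ltW.
Qed.

Definition kernel (t : R) n (x y : 'rV[R]_n) : R :=
  (enorm (x - y) ^+ 2 + t ^+ 2) `^ (- (n.+1%:R / 2)).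

Lemma kernelE t n (x y : 'rV[R]_n) :
  kernel t x y = cone_norm t (x - y) `^ (- n.+1%:R).
Proof.
rewrite /kernel enorm_sqr /cone_norm -powR12_sqrt; last first.
  by rewrite addr_ge0 ?sqnorm_ge0 ?sqr_ge0.
by rewrite -powRrM mulrN mulrC.
Qed.

Lemma kernel_gt0 t n (x y : 'rV[R]_n) : 0 < t -> 0 < kernel t x y.
Proof. by move=> t0; rewrite kernelE powR_gt0// cone_norm_gt0. Qed.

Lemma kernel_le t n (x y : 'rV[R]_n) : 0 < t -> kernel t x y <= t `^ (- n.+1%:R).
Proof.
move=> t0; rewrite kernelE; apply: ler_powR_npos; rewrite ?oppr_le0//.
apply: (@le_trans _ _ (Num.sqrt (t ^+ 2))); first by rewrite sqrtr_sqr gtr0_norm.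
by rewrite ler_sqrt ?lerDr ?sqnorm_ge0// addr_ge0 ?sqnorm_ge0 ?sqr_ge0.
Qed.

Lemma measurable_sqnorm_sub n (x : 'rV[R]_n) :
  measurable_fun setT (fun y : 'rV[R]_n => sqnorm (x - y)).
Proof.
rewrite /sqnorm; apply: measurable_sum => i; apply: measurable_funX.
under eq_fun do rewrite !mxE.
by apply: measurable_funB => //; exact: measurable_coord.
Qed.

Lemma measurable_kernel t n (x : 'rV[R]_n) : measurable_fun setT (kernel t x).
Proof.
apply: (measurableT_comp (measurable_powR _)).
apply: measurable_funD => //.
under eq_fun do rewrite enorm_sqr.
exact: measurable_sqnorm_sub.
Qed.

(** Finiteness matters too, since [fine] sends infinity to 0. The cone over the sphere is the unit
    ball, which lies between two cubes. *)
Lemma sphere_measure_gt0 n :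
  0 < fine (sphere_measure (@sphere R n)).
Proof.
pose E : set 'rV[R]_n.+1 := [set x | sqnorm x <= 1].
have norm1 (u : 'rV[R]_n.+1) : sphere u <-> sqnorm u = 1.
  rewrite /sphere /= -enorm_sqr; split => [->|/eqP]; first by rewrite expr1n.
  by rewrite sqrp_eq1 ?sqrtr_ge0// => /eqP.
have coneE : [set (r *: u : 'rV[R]_n.+1) | r in `[0%R, 1%R] & u in @sphere R n] = E.
  apply/seteqP; split => [_ [r r01 [u /norm1 u1 <-]]|x xE].
    move: r01; rewrite /= in_itv/= => /andP[r0 r1].
    by rewrite /E/= sqnormZ u1 mulr1 expr_le1.
  have [x0|x0] := eqVneq x 0.
    exists 0; first by rewrite /= in_itv/= lexx ler01.
    exists (delta_mx ord0 ord0); last by rewrite scale0r x0.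
    apply/norm1; rewrite /sqnorm big_ord_recl !mxE !eqxx expr1n big1 ?addr0//.
    by move=> i _; rewrite !mxE expr0n.
  have ex0 : 0 < sqnorm x.
    rewrite lt_neqAle sqnorm_ge0 andbT eq_sym; apply: contra x0 => /eqP s0.
    apply/eqP/rowP => i; rewrite mxE; apply/eqP; rewrite -sqrf_eq0 eq_le sqr_ge0.
    by rewrite -s0 sqr_coord_le.
  have e0 : 0 < enorm x by rewrite sqrtr_gt0.
  exists (enorm x).
    rewrite /= in_itv/= (ltW e0)/= -(@expr_le1 _ 2)// ?(ltW e0)//.
    by rewrite enorm_sqr.
  exists ((enorm x)^-1 *: x); last by rewrite scalerA mulfV ?gt_eqF// scale1r.
  by apply/norm1; rewrite sqnormZ -enorm_sqr exprVn mulVf ?gt_eqF// exprn_gt0.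
have mE : measurable E.
  rewrite (_ : E = ~` [set x | cst 1 x < sqnorm (0 - x)]); last first.
    apply/seteqP; split => x; rewrite /E/= sub0r -scaleN1r sqnormZ sqrrN expr1n mul1r.
      by move=> x1; apply/negP; rewrite -leNgt.
    by move/negP; rewrite -leNgt.
  apply: measurableC; apply: measurable_set_ltr => //.
  exact: measurable_sqnorm_sub.
have N0 : 0 < n.+1%:R :> R by [].
have low : cube 0 n.+1%:R^-1 `<=` E.
  move=> x xc; rewrite /E/=.
  have : sqnorm x <= \sum_(i < n.+1) n.+1%:R^-1.
    apply: ler_sum => i _; have := xc i; rewrite mxE subr0 => xi.
    rewrite -real_normK ?num_real// expr2 -[leRHS]mulr1 ler_pM//.
    by rewrite (le_trans xi)// invf_le1// ler1n.
  by rewrite sumr_const card_ord -[X in _ <= X]mulr_natr mulVf// pnatr_eq0.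
have up : E `<=` cube 0 1.
  move=> x xE i; rewrite mxE subr0 -(@expr_le1 _ 2)// real_normK ?num_real//.
  exact: le_trans (sqr_coord_le _ _) xE.
have lowE : (0 < @lebesgue_rV R n.+1 E)%E.
  apply: (@lt_le_trans _ _ (@lebesgue_rV R n.+1 (cube 0 n.+1%:R^-1))).
    by rewrite lebesgue_rV_cube ?invr_ge0 ?(ltW N0)// lte_fin.
  by apply: le_measure; rewrite ?inE//; exact: measurable_cube.
have upE : (@lebesgue_rV R n.+1 E < +oo)%E.
  apply: (@le_lt_trans _ _ (@lebesgue_rV R n.+1 (cube 0 1))).
    by apply: le_measure; rewrite ?inE//; exact: measurable_cube.
  by rewrite lebesgue_rV_cube// ltry.
rewrite /sphere_measure coneE; apply: fine_gt0; apply/andP; split.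
  by rewrite mule_gt0// lte_fin.
by rewrite lte_mul_pinfty// ?lee_fin.
Qed.

End poisson_kernel.

(** * Strict concavity of the Poisson integral *)

Section exponents.
Context {R : realType}.

Definition inv_exponent (q : \bar R) : R := if q is r%:E then r^-1 else 0.

Lemma inv_exponent_bounds (q : \bar R) : (1%:E <= q)%E -> 0 <= inv_exponent q <= 1.
Proof.
case: q => [r| |]//=; last by rewrite lexx ler01.
rewrite lee_fin => r1; have r0 : 0 < r by exact: lt_le_trans r1.
by rewrite invr_ge0 (ltW r0) invf_le1.
Qed.

Lemma pmean_invE (q : \bar R) (a b l : R) : (1%:E <= q)%E -> 0 < a -> 0 < b ->
  pmean q a b l = if inv_exponent q == 0 then Num.max a b
    else ((1 - l) * a `^ (inv_exponent q)^-1 + l * b `^ (inv_exponent q)^-1)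
         `^ inv_exponent q.
Proof.
move=> q1 a0 b0; rewrite /pmean mulf_eq0 (gt_eqF a0) (gt_eqF b0) orFb.
case: q q1 => [r|_|]; [rewrite lee_fin => r1|by rewrite /= eqxx|by []].
have r0 : 0 < r by exact: lt_le_trans r1.
by rewrite /inv_exponent invr_eq0 (gt_eqF r0) invrK.
Qed.

(** Indeed [q / (1 - q) = - 1 / (1 - 1 / q)]; the exponent [-oo] at [q = 1] is the parameter 0. *)
Lemma pmean_concavity_exponent (q : \bar R) (a b l : R) : (1%:E <= q)%E ->
  0 < a -> 0 < b ->
  pmean (concavity_exponent q) a b l = inv_mean l (1 - inv_exponent q) a b.
Proof.
move=> q1 a0 b0; rewrite /pmean mulf_eq0 (gt_eqF a0) (gt_eqF b0) orFb.
case: q q1 => [r|_|]; [rewrite lee_fin => r1| |by []]; last first.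
  rewrite /concavity_exponent /inv_mean subr0 oner_eq0 invr1 oppr_eq0 oner_eq0.
  by rewrite invrN invr1.
have r0 : 0 < r by exact: lt_le_trans r1.
rewrite /concavity_exponent /inv_exponent.
have [->|rN1] := eqVneq r 1; first by rewrite /inv_mean invr1 subrr eqxx.
have rm : 1 - r != 0 by rewrite subr_eq0 eq_sym.
have am : 1 - r^-1 != 0 by rewrite subr_eq0 eq_sym invr_eq1.
have r' : r != 0 by rewrite gt_eqF.
rewrite /inv_mean (negbTE am) mulf_eq0 invr_eq0 (negbTE rm) (negbTE r').
have rm' : r - 1 != 0 by rewrite subr_eq0.
have -> : - (1 - r^-1)^-1 = r / (1 - r) by field; rewrite ?r' ?rm ?rm'.
have -> // : (r / (1 - r))^-1 = - (1 - r^-1) by field; rewrite ?r' ?rm.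
Qed.

Lemma inv_mean_refl (l alpha a : R) : 0 < a -> inv_mean l alpha a a = a.
Proof.
move=> a0; rewrite /inv_mean; case: ifPn => [_|al]; first by rewrite minxx.
by rewrite -mulrDl subrK mul1r -powRrM mulrNN mulVf// powRr1// ltW.
Qed.

Lemma inv_mean0 (alpha a b : R) : 0 < a -> inv_mean 0 alpha a b <= a.
Proof.
move=> a0; rewrite /inv_mean; case: ifPn => [_|al]; first by rewrite ge_min lexx.
by rewrite subr0 mul1r mul0r addr0 -powRrM mulrNN mulVf// powRr1// ltW.
Qed.

Lemma inv_mean1 (alpha a b : R) : 0 < b -> inv_mean 1 alpha a b <= b.
Proof.
move=> b0; rewrite /inv_mean; case: ifPn => [_|al].
  by rewrite ge_min lexx orbT.
by rewrite subrr mul1r mul0r add0r -powRrM mulrNN mulVf// powRr1// ltW.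
Qed.

Lemma wmean_le_pmean (q : \bar R) (a b l : R) : (1%:E <= q)%E -> 0 < a -> 0 < b ->
  0 <= l <= 1 -> (1 - l) * a + l * b <= pmean q a b l.
Proof.
move=> q1 a0 b0 /andP[l0 l1]; have ml : 0 <= 1 - l by rewrite subr_ge0.
rewrite /pmean mulf_eq0 (gt_eqF a0) (gt_eqF b0) orFb.
case: q q1 => [r|_|]; [rewrite lee_fin => r1| |by []]; last first.
  set m := Num.max a b.
  have -> : m = (1 - l) * m + l * m by ring.
  by rewrite lerD// ler_wpM2l// le_max lexx ?orbT.
have r0 : 0 < r by exact: lt_le_trans r1.
rewrite (gt_eqF r0).
have := @convex_powR R r r1 (Itv01 l0 l1) b a.
rewrite !inE/= !in_itv/= !andbT => /(_ (ltW b0) (ltW a0)).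
rewrite convRE [X in X `^ _ <= _]convRE /= /unstable.onem => H.
have s0 : 0 <= (1 - l) * a + l * b by rewrite addr_ge0 ?mulr_ge0 ?(ltW a0) ?(ltW b0).
rewrite -[leLHS]powRr1// -[X in _ `^ X](mulfV (lt0r_neq0 r0)) powRrM.
apply: ge0_ler_powR; rewrite ?nnegrE ?powR_ge0 ?invr_ge0 ?(ltW r0)//.
  by rewrite addr_ge0// mulr_ge0// powR_ge0.
by rewrite addrC [leRHS]addrC.
Qed.

End exponents.

Lemma integral_gt0 d (T : measurableType d) (R : realType)
    (mu : {measure set T -> \bar R}) (f : T -> R) (E : set T) :
  measurable_fun setT f -> (forall x, 0 <= f x) -> measurable E ->
  (0 < mu E)%E -> (forall x, E x -> 0 < f x) -> (0 < \int[mu]_x (f x)%:E)%E.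
Proof.
move=> mf f0 mE E0 fE; rewrite lt_neqAle integral_ge0 ?andbT; last first.
  by move=> x _; rewrite lee_fin.
apply/negP => /eqP/esym I0.
have mfE : measurable_fun setT (EFin \o f) by exact/measurable_EFinP.
have /(ae_eq_integral_abs mu measurableT mfE) : (\int[mu]_x `|(EFin \o f) x| = 0)%E.
  rewrite -[RHS]I0; apply: eq_integral => x _ /=.
  by rewrite ger0_norm.
move=> [N [mN N0 fN]]; move: E0; rewrite (_ : mu E = 0%E) ?ltxx//.
apply: (subset_measure0 mE mN) => // x Ex; apply: fN => /= H.
by move: (fE _ Ex); have [->] := H I; rewrite ltxx.
Qed.

Lemma lebesgue_rV_cube_gt0 (R : realType) (n : nat) (x : 'rV[R]_n) (r : R) :
  0 < r -> (0 < @lebesgue_rV R n (cube x r))%E.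
Proof.
move=> r0; rewrite lebesgue_rV_cube ?(ltW r0)// lte_fin.
by rewrite exprn_gt0// mulr_gt0.
Qed.

(* Near the part of the support that is extremal in the direction [v], no point
   is a convex combination of two points of the support differing by [v]. *)
Lemma extremal_cube (R : realType) (n : nat) (g : 'rV[R]_n -> R) (M l : R)
    (v : 'rV[R]_n) :
  (forall x, 0 <= g x) ->
  (forall x y l, 0 <= l <= 1 -> 0 < g x -> 0 < g y ->
    (1 - l) * g x + l * g y <= g ((1 - l) *: x + l *: y)) ->
  support_interior g !=set0 -> 0 <= M ->
  (forall x, 0 < g x -> forall i, `|x ord0 i| <= M) ->
  v != 0 -> 0 < l < 1 ->
  exists z, exists r, exists d, [/\ 0 < r, 0 < d,
    cube z r `<=` support_interior g &
    forall y0 y1, 0 < g y0 -> 0 < g y1 -> cube z r ((1 - l) *: y0 + l *: y1) ->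
      d <= sqnorm (v - (y1 - y0))].
Proof.
move=> g0 gc [p Up] M0 BM v0 /andP[l0 l1].
have ml0 : 0 < 1 - l by rewrite subr_gt0.
have [i vi] : exists i, v ord0 i != 0.
  apply: contrapT => H; move/negP: v0; apply; apply/eqP/rowP => i.
  by rewrite mxE; apply: contrapT => /eqP vi; apply: H; exists i.
pose s := Num.sg (v ord0 i); pose phi (y : 'rV[R]_n) := s * y ord0 i.
have phiD a b (x y : 'rV[R]_n) : phi (a *: x + b *: y) = a * phi x + b * phi y.
  by rewrite /phi !mxE; ring.
have s1 : `|s| = 1 by rewrite normr_sg vi.
have phi_abs y : `|phi y| = `|y ord0 i| by rewrite /phi normrM s1 mul1r.
have phi_le y : phi y <= `|y ord0 i| by rewrite -phi_abs ler_norm.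
have phi_lip x y : phi x - phi y <= `|y ord0 i - x ord0 i|.
  rewrite distrC (_ : phi x - phi y = phi (x - y)); last by rewrite /phi !mxE; ring.
  by apply: (le_trans (phi_le _)); rewrite !mxE.
have phiB y : 0 < g y -> - M <= phi y <= M.
  by move=> gy; rewrite -ler_norml phi_abs BM.
have Bp : 0 < g p by exact: sub_support_interior Up.
pose S := sup [set phi y | y in [set y | 0 < g y]].
have hs : has_sup [set phi y | y in [set y | 0 < g y]].
  split; first by exists (phi p); exists p.
  by exists M => _ [y gy <-]; case/andP: (phiB _ gy).
have phiS y : 0 < g y -> phi y <= S.
  by move=> gy; apply: ub_le_sup; [case: hs|exists y].
have SM : S <= M.
  by apply: ge_sup; [case: hs|move=> _ [y gy <-]; case/andP: (phiB _ gy)].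
(* For [y = (1 - l) *: y0 + l *: y1] one has [y1 = y + (1 - l) *: (y1 - y0)], so [y1 - y0 = v] would
   force [phi y <= S - eta]. Of this margin, the choice of [b], the move from [b] to [z] and the
   size of the cube each use a quarter; the last quarter yields [d]. *)
pose eta := (1 - l) * `|v ord0 i|.
have eta0 : 0 < eta by rewrite mulr_gt0// normr_gt0.
have e40 : 0 < eta / 4 by rewrite divr_gt0.
have [_ [b gb <-] bS] := sup_adherent e40 hs.
(* [b] may lie on the boundary, so it is pushed towards the interior point [p]; this weight keeps
   the loss in [phi] below [eta / 4]. *)
pose w := eta / (8 * (M + 1) + eta).
have den0 : 0 < 8 * (M + 1) + eta by rewrite addr_gt0// mulr_gt0// ltr_wpDl.
have w0 : 0 < w by rewrite divr_gt0.
have w1 : w < 1 by rewrite ltr_pdivrMr// mul1r ltrDr mulr_gt0// ltr_wpDl.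
have wM : w * (2 * M) <= eta / 4.
  rewrite /w mulrAC ler_pdivrMr// -(mulrA eta 4^-1) ler_pM2l//.
  by move: eta0; lra.
pose z := (1 - (1 - w)) *: p + (1 - w) *: b.
have Uz : support_interior g z.
  by apply: support_interior_conv => //; rewrite subr_ge0 (ltW w1) gtrBl w0.
have zS : S - eta / 2 <= phi z.
  rewrite phiD subKr.
  have /andP[pM _] := phiB _ Bp.
  have : w * (S - phi p) <= w * (2 * M) by rewrite ler_pM2l//; lra.
  have : (1 - w) * (S - eta / 4) <= (1 - w) * phi b.
    by rewrite ler_pM2l ?subr_gt0// ltW.
  have : 0 <= w * (eta / 4) by rewrite mulr_ge0 ?(ltW w0) ?(ltW e40).
  lra.
have [r' r'0 r'U] := support_interior_open Uz.
pose r := Num.min r' (eta / 4).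
have r0 : 0 < r by rewrite lt_min r'0.
exists z, r, ((eta / (4 * (1 - l))) ^+ 2); split => //.
- by rewrite exprn_gt0// divr_gt0// mulr_gt0.
- apply: subset_trans r'U => y yz j; apply: (le_trans (yz j)).
  by rewrite ge_min lexx.
move=> y0 y1 gy0 gy1 yz; apply: le_trans (sqr_coord_le _ i).
set y := (1 - l) *: y0 + l *: y1 in yz.
have yS : S - 3 * eta / 4 <= phi y.
  have : phi z - phi y <= eta / 4.
    apply: (le_trans (phi_lip _ _)).
    by apply: (le_trans (yz i)); rewrite ge_min lexx orbT.
  lra.
have vE : phi v = `|v ord0 i| by rewrite /phi /s -normrEsg.
have dE : phi (v - (y1 - y0)) = `|v ord0 i| - (phi y1 - phi y0).
  by rewrite -vE /phi !mxE; ring.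
have y1S : phi y + (1 - l) * (phi y1 - phi y0) <= S.
  rewrite /y phiD; have := phiS _ gy1; lra.
have d4 : eta / 4 <= (1 - l) * phi (v - (y1 - y0)).
  by rewrite dE mulrBr -/eta; lra.
have dd : eta / (4 * (1 - l)) <= phi (v - (y1 - y0)).
  by rewrite invfM mulrA ler_pdivrMr// [leRHS]mulrC.
have q0 : 0 <= eta / (4 * (1 - l)) by rewrite ltW// divr_gt0// mulr_gt0.
rewrite -[leRHS]real_normK ?num_real// -phi_abs ler_pXn2r ?nnegrE//.
exact: le_trans (ler_norm _).
Qed.

Section poisson_integral.
Context {R : realType} {n : nat}.
Variables (g : 'rV[R]_n -> R) (q : \bar R) (t M : R).
Hypothesis g0 : forall x, 0 <= g x.
Hypothesis q1 : (1%:E <= q)%E.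
Hypothesis gq : forall (x0 x1 : 'rV[R]_n) (l : R), 0 <= l <= 1 ->
  pmean q (g x0) (g x1) l <= g ((1 - l) *: x0 + l *: x1).
Hypothesis U0 : support_interior g !=set0.
Hypothesis M0 : 0 <= M.
Hypothesis BM : forall x, 0 < g x -> forall i, `|x ord0 i| <= M.
Hypothesis t0 : 0 < t.

Let gc x y l : 0 <= l <= 1 -> 0 < g x -> 0 < g y ->
  (1 - l) * g x + l * g y <= g ((1 - l) *: x + l *: y).
Proof.
by move=> l01 gx gy; apply: le_trans (gq _ _ l01); exact: wmean_le_pmean.
Qed.

Let F (x y : 'rV[R]_n) : R := kernel t x y * support_trim g y.

Let mF x : measurable_fun setT (F x).
Proof.
by apply: measurable_funM; [exact: measurable_kernel|exact: measurable_support_trim].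
Qed.

Let F0 x y : 0 <= F x y.
Proof. by rewrite mulr_ge0 ?support_trim_ge0// ltW// kernel_gt0. Qed.

Let F_gt0 x y : 0 < F x y <-> support_interior g y.
Proof.
rewrite -support_trim_gt0; split; first by rewrite pmulr_rgt0// kernel_gt0.
by move=> ty; rewrite mulr_gt0// kernel_gt0.
Qed.

Let F_bounded : exists C, forall x, bounded_in_cube M C (F x).
Proof.
have [C gC] := concave_support_bounded g0 gc U0 BM.
exists (t `^ (- n.+1%:R) * C) => x; split; first exact: mF.
  move=> y; rewrite F0/= ler_pM ?support_trim_ge0 ?kernel_le//.
    by rewrite ltW// kernel_gt0.
  exact: le_trans (support_trim_le g0 _) (gC _).
by move=> y /F_gt0 Uy; apply: BM; exact: sub_support_interior.
Qed.

Definition poisson_mass (x : 'rV[R]_n) : R :=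
  fine (\int[@lebesgue_rV R n]_y (kernel t x y * support_trim g y)%:E).

Lemma poisson_massE x :
  (\int[@lebesgue_rV R n]_y (F x y)%:E = (poisson_mass x)%:E)%E.
Proof.
have [C FC] := F_bounded; rewrite fineK//.
exact: fin_num_integral_in_cube M0 (FC x).
Qed.

Lemma poisson_mass_gt0 x : 0 < poisson_mass x.
Proof.
rewrite -lte_fin -poisson_massE.
have [p Up] := U0; have [r r0 rU] := support_interior_open Up.
apply: (@integral_gt0 _ _ _ _ _ (cube p r)) => //.
- exact: measurable_cube.
- exact: lebesgue_rV_cube_gt0.
- by move=> y /rU Uy; apply/F_gt0.
Qed.

Lemma poisson_mass_strict (x0 x1 : 'rV[R]_n) (l : R) : x0 != x1 -> 0 < l < 1 ->
  inv_mean l (1 - inv_exponent q) (poisson_mass x0) (poisson_mass x1) <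
  poisson_mass ((1 - l) *: x0 + l *: x1).
Proof.
move=> x01 l01; have /andP[l0 l1] := l01.
set kappa := inv_exponent q; set xl := _ + l *: x1.
have /andP[ka0 ka1] := inv_exponent_bounds q1.
(* Positive dimension yields [kappa < n + 1] even when [kappa = 1]. *)
have n0 : (0 < n)%N.
  rewrite lt0n; apply: contra x01 => /eqP n0.
  by apply/eqP/rowP => i; have := ltn_ord i; rewrite {2}n0.
have v0 : x1 - x0 != 0 by rewrite subr_eq0 eq_sym.
have [z [r [d [r0 d0 rU far]]]] := extremal_cube g0 gc U0 M0 BM v0 l01.
pose D := cube z r; have mD : measurable D by exact: measurable_cube.
have [C FC] := F_bounded.
have [K K0 KB] : exists2 K, 0 < K & forall y, 0 < g y ->
    cone_norm t (x0 - y) <= K /\ cone_norm t (x1 - y) <= K.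
  pose c (x : 'rV[R]_n) := \sum_(i < n) (`|x ord0 i| + M) ^+ 2 + t ^+ 2.
  have c0 x : 0 < c x.
    rewrite ltr_wpDl ?exprn_gt0//; apply: sumr_ge0 => i _; exact: sqr_ge0.
  have cB x y : 0 < g y -> cone_norm t (x - y) <= Num.sqrt (c x).
    move=> gy; rewrite ler_sqrt ?(ltW (c0 _))// lerD2r; apply: ler_sum => i _.
    rewrite !mxE -real_normK ?num_real// ler_pXn2r ?nnegrE ?addr_ge0//.
    by rewrite (le_trans (ler_normB _ _))// lerD2l BM.
  exists (Num.sqrt (c x0) + Num.sqrt (c x1)).
    by rewrite addr_gt0// sqrtr_gt0.
  move=> y gy; split; apply: (le_trans (cB _ _ gy)).
    by rewrite lerDl sqrtr_ge0.
  by rewrite lerDr sqrtr_ge0.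
have [rho rho1 gap] := @cone_norm_conv_ratio R t l K d n t0 l01 K0 d0.
have rho0 : 0 < rho by exact: lt_trans rho1.
pose c := rho `^ (- n.+1%:R).
have c0 : 0 < c by rewrite powR_gt0.
have c1 : c < 1.
  rewrite /c powRN invf_lt1 ?powR_gt0// powR_mulrn ?(ltW rho0)//.
  by rewrite exprn_egt1.
have ga1 : 1 <= n.+1%:R :> R by rewrite ler1n.
have kaga : kappa < n.+1%:R.
  by rewrite (le_lt_trans ka1)// ltr1n.
(* To be applied with [rho' = rho] over [D] and with [rho' = 1] elsewhere. *)
have pointwise rho' y0 y1 : 0 < rho' ->
    support_interior g y0 -> support_interior g y1 ->
    rho' * cone_norm t (xl - ((1 - l) *: y0 + l *: y1)) <=
      (1 - l) * cone_norm t (x0 - y0) + l * cone_norm t (x1 - y1) ->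
    inv_mean l (n.+1%:R - kappa) (F x0 y0) (F x1 y1) <=
      rho' `^ (- n.+1%:R) * F xl ((1 - l) *: y0 + l *: y1).
  move=> rho'0 Uy0 Uy1 rhoP.
  have B0 := sub_support_interior Uy0; have B1 := sub_support_interior Uy1.
  have Uy : support_interior g ((1 - l) *: y0 + l *: y1).
    by apply: support_interior_conv => //; rewrite (ltW l0).
  rewrite /F !support_trim_in// !kernelE.
  apply: le_trans (inv_mean_ratio l01 ka0 ga1 kaga _ _ B0 B1) _;
    rewrite ?cone_norm_gt0//.
  rewrite -pmean_invE// mulrA -powRM ?(ltW rho'0) ?(ltW (cone_norm_gt0 _ t0))//.
  apply: ler_pM; rewrite ?powR_ge0//.
  - apply: le_trans (wmean_le_pmean q1 B0 B1 _); last by rewrite (ltW l0) ltW.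
    by rewrite ltW// wsum_gt0.
  - apply: ler_powR_npos => //.
    by rewrite mulr_gt0// cone_norm_gt0.
  - by apply: gq; rewrite (ltW l0) ltW.
have diffE y0 y1 : xl - ((1 - l) *: y0 + l *: y1) =
    (1 - l) *: (x0 - y0) + l *: (x1 - y1).
  by rewrite /xl; apply/rowP => i; rewrite !mxE; ring.
(* This is [F xl] multiplied by [c] over [D]. Written as a difference, it displays the removed mass,
   which is positive because [D] lies inside the support. *)
pose h y := F xl y - (1 - c) * (F xl y * \1_D y).
have c1' : 0 < 1 - c by rewrite subr_gt0.
have hE y : h y = (if y \in D then c else 1) * F xl y.
  by rewrite /h indicE; case: (y \in D); rewrite /=; ring.
have mFD : measurable_fun setT (fun y => F xl y * \1_D y).
  by apply: measurable_funM => //; exact: mF.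
have hB : bounded_in_cube M C h.
  have [_ FlC _] := FC xl; split.
  - apply: measurable_funB; first exact: mF.
    exact: measurable_funM.
  - move=> y; rewrite hE; have /andP[_ FyC] := FlC y.
    have yF0 := F0 xl y.
    case: ifP => _; last by rewrite mul1r yF0.
    rewrite mulr_ge0 ?(ltW c0)//=; apply: le_trans FyC.
    by rewrite ler_piMl// ltW.
  - move=> y; rewrite hE pmulr_rgt0; last by case: ifP.
    by move=> /F_gt0 Uy; apply: BM; exact: sub_support_interior.
have bbl : ((inv_mean l (1 - kappa) (poisson_mass x0) (poisson_mass x1))%:E <=
    \int[@lebesgue_rV R n]_y (h y)%:E)%E.
  rewrite (_ : 1 - kappa = (n.+1%:R - kappa) - n%:R); last first.
    by rewrite -natr1; ring.
  apply: (@borell_brascamp_lieb R n l (n.+1%:R - kappa) M C _ _ (F x0) (F x1)) => //.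
  - by rewrite -natr1 -addrA lerDl subr_ge0.
  - exact: poisson_mass_gt0.
  - exact: poisson_mass_gt0.
  - exact: poisson_massE.
  - exact: poisson_massE.
  move=> y0 y1 /F_gt0 Uy0 /F_gt0 Uy1; rewrite hE.
  have B0 := sub_support_interior Uy0; have B1 := sub_support_interior Uy1.
  case: ifPn => [yD|_]; last first.
    have := @pointwise 1 y0 y1 ltr01 Uy0 Uy1; rewrite powR1; apply.
    by rewrite mul1r diffE; exact: cone_norm_conv.
  apply: pointwise => //; rewrite diffE; apply: gap.
  - by case: (KB _ B0).
  - by case: (KB _ B1).
  (* The gain in convexity depends on the difference of [x1 - y1] and [x0 - y0], which
     [extremal_cube] keeps away from 0 over [D]. *)
  rewrite (_ : _ - _ = (x1 - x0) - (y1 - y0)).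
    by apply: far => //; rewrite inE in yD.
  by apply/rowP => i; rewrite !mxE; ring.
have FD0 y : 0 <= F xl y * \1_D y by rewrite mulr_ge0// F0.
have h0 y : 0 <= h y by exact: bounded_in_cube_ge0 hB.
have split_mass : ((poisson_mass xl)%:E = \int[@lebesgue_rV R n]_y (h y)%:E +
    (1 - c)%:E * \int[@lebesgue_rV R n]_y (F xl y * \1_D y)%:E)%E.
  rewrite -poisson_massE -ge0_integralZl_EFin ?(ltW c1')//; last 2 first.
  - by move=> y _; rewrite lee_fin.
  - exact/measurable_EFinP.
  rewrite -ge0_integralD//.
  - by apply: eq_integral => y _; rewrite -EFinM -EFinD subrK.
  - by move=> y _; rewrite lee_fin.
  - by case: hB => mh _ _; exact/measurable_EFinP.
  - by move=> y _; rewrite -EFinM lee_fin mulr_ge0 ?(ltW c1').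
  - by apply: measurable_funeM; exact/measurable_EFinP.
rewrite -lte_fin split_mass; apply: (le_lt_trans bbl).
rewrite lteDl ?(fin_num_integral_in_cube M0 hB)//.
rewrite mule_gt0 ?lte_fin//.
apply: (@integral_gt0 _ _ _ _ _ D) => //.
- exact: lebesgue_rV_cube_gt0.
- move=> y Dy; rewrite indicE mem_set// mulr1.
  by apply/F_gt0; exact: rU.
Qed.

Lemma poissonE x : poisson g x t =
  (2 * t / fine (sphere_measure (@sphere R n)) * poisson_mass x)%:E.
Proof.
rewrite EFinM -poisson_massE /poisson; congr (_ * _)%E.
apply: (integral_support_trim g0 gc U0 M0 BM (measurable_kernel t x)) => y.
exact: kernel_gt0.
Qed.

End poisson_integral.

Lemma support_bounded_coord (R : realType) (n : nat) (g : 'rV[R]_n -> R) :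
  bounded_set (~` (g @^-1` [set 0])) ->
  exists2 M, 0 <= M & forall x, 0 < g x -> forall i, `|x ord0 i| <= M.
Proof.
move=> /pinfty_ex_gt0[M M0 BM]; exists M; first exact: ltW.
move=> x gx i; apply: le_trans (BM x _); last by move=> /= gx0; rewrite gx0 ltxx in gx.
rewrite [leRHS]mx_normrE.
exact: (le_bigmax _ (fun j => `|x j.1 j.2|) (ord0, i)).
Qed.

Lemma support_interior_nonempty (R : realType) (n : nat) (g : 'rV[R]_n -> R) :
  (forall x, 0 <= g x) ->
  (~` (g @^-1` [set 0]))° !=set0 -> support_interior g !=set0.
Proof.
move=> g0 [p /nbhs_ballP[e /= e0 pe]]; exists p, (e / 2); first by rewrite divr_gt0.
move=> y py /=; rewrite lt_neqAle g0 eq_sym andbT; apply/eqP.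
apply: pe; split => // i j; rewrite ord1 /ball/= distrC.
by apply: (le_lt_trans (py j)); rewrite ltr_pdivrMr// ltr_pMr// ltr1n.
Qed.

Theorem proposition3p18 (R : realType) (n : nat) (g : 'rV[R]_n -> R)
    (q : \bar R)
    (q_real_or_pinfty : q != -oo%E)
    (g_ge0 : forall x, 0 <= g x)
    (g_concave : p_concave q setT g)
    (g_supp_bounded : bounded_set (~` (g @^-1` [set 0])))
    (g_supp_interior : (~` (g @^-1` [set 0]))° !=set0)
    (q_ge1 : (1%:E <= q)%E) :
  forall t : R, 0 < t ->
    (forall x, (0 < poisson g x t)%E /\ (poisson g x t < +oo)%E) /\
    strictly_p_concave (concavity_exponent q) setT
      (fun x => fine (poisson g x t)).
Proof.
move=> t t0; have [M M0 BM] := support_bounded_coord g_supp_bounded.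
have U0 := support_interior_nonempty g_ge0 g_supp_interior.
have gq (x0 x1 : 'rV[R]_n) (l : R) : 0 <= l <= 1 ->
    pmean q (g x0) (g x1) l <= g ((1 - l) *: x0 + l *: x1).
  by case: g_concave => _ _ H; exact: H.
pose c := 2 * t / fine (sphere_measure (@sphere R n)).
have c0 : 0 < c by apply: divr_gt0; [rewrite mulr_gt0|exact: sphere_measure_gt0].
pose P x := c * poisson_mass g t x.
have PE x : poisson g x t = (P x)%:E by exact: (poissonE g_ge0 q_ge1 gq U0 M0 BM).
have P0 x : 0 < P x.
  by rewrite mulr_gt0//; exact: (poisson_mass_gt0 g_ge0 q_ge1 gq U0 M0 BM).
have strict (x0 x1 : 'rV[R]_n) (l : R) : x0 != x1 -> 0 < l < 1 ->
    pmean (concavity_exponent q) (P x0) (P x1) l < P ((1 - l) *: x0 + l *: x1).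
  move=> x01 l01; rewrite pmean_concavity_exponent//.
  have m0 x : 0 < poisson_mass g t x.
    exact: (poisson_mass_gt0 g_ge0 q_ge1 gq U0 M0 BM).
  have /andP[_ ka1] := inv_exponent_bounds q_ge1.
  rewrite (inv_meanZ l01) ?subr_ge0// ltr_pM2l//.
  exact: (poisson_mass_strict g_ge0 q_ge1 gq U0 M0 BM).
split; first by move=> x; rewrite PE lte_fin P0 ltry.
rewrite (_ : (fun x => _) = P); last by apply/funext => x; rewrite PE.
split; last by move=> x0 x1 l _ _; exact: strict.
split => [x y l _ _|x _|x0 x1 l _ _ /andP[l0 l1]]; first by rewrite inE.
  exact: ltW.
(* Equal points and the endpoint weights, which the strict inequality excludes, are settled
   directly. *)
have [->|x01] := eqVneq x0 x1.
  by rewrite -scalerDl subrK scale1r pmean_concavity_exponent// inv_mean_refl.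
have [->|lN0] := eqVneq l 0.
  by rewrite subr0 scale1r scale0r addr0 pmean_concavity_exponent// inv_mean0.
have [->|lN1] := eqVneq l 1.
  by rewrite subrr scale1r scale0r add0r pmean_concavity_exponent// inv_mean1.
by apply: ltW; apply: strict => //; rewrite !lt_neqAle eq_sym lN0 lN1 l0.
Qed.
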